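(* Let $R$ be an affine domain of characteristic zero with finite quotients, let $n$ be a positive integer, and let $f \in R[x_1,\dots,x_n]^n$. For every maximal ideal $\mathfrak{m} \subseteq R$ choose a subring $S(\mathfrak{m})$ of $\widehat{R_{\mathfrak{m}}}$ containing $R$. Then the polynomial map $f \colon R^n \to R^n$ is surjective if and only if the polynomial map $f \colon S(\mathfrak{m})^n \to S(\mathfrak{m})^n$ is surjective for every maximal ideal $\mathfrak{m} \subseteq R$.
   Context: All rings are commutative with unity. A domain $R$ is called affine if it is either finitely generated as a ring (i.e. as a $\mathbb{Z}$-algebra) or finitely generated as an algebra over a subfield. An affine domain $R$ has finite quotients if $R/\mathfrak{m}$ is finite for every maximal ideal $\mathfrak{m} \subseteq R$. For $f = (f_1,\dots,f_n) \in R[x_1,\dots,x_n]^n$ and an $R$-algebra $S$, the polynomial map $f \colon S^n \to S^n$ is $a \mapsto (f_1(a),\dots,f_n(a))$. For a maximal ideal $\mathfrak{m} \subseteq R$, $\widehat{R_{\mathfrak{m}}}$ denotes the completion of $R$ with respect to $\mathfrak{m}$ (equivalently, the completion of the localization $R_{\mathfrak{m}}$ with respect to its maximal ideal); $R$ is regarded as a subring of $\widehat{R_{\mathfrak{m}}}$ via the canonical (injective) map. *)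

(* Defs.v *)
From HB Require Import structures.
From mathcomp Require Import all_boot all_order all_algebra.
From mathcomp Require Import boolp classical_sets cardinality.
From mathcomp Require Import mpoly.

Set Implicit Arguments.
Unset Strict Implicit.
Unset Printing Implicit Defensive.

Import GRing.Theory.
Local Open Scope ring_scope.

Section AffineDomains.
Variable R : idomainType.

Definition finitely_generated_ring : Prop :=
  exists (k : nat) (g : 'I_k -> R),
    forall r : R, exists p : {mpoly int[k]}, r = mmap intr g p.

(* This is not [GRing.divring_closed]: as x^-1 = x for a non-unit x, a subring
   without nontrivial units satisfies the latter without being a field. *)
Definition is_subfield (K : {pred R}) : Prop :=
  GRing.subring_closed K /\
  {in K, forall x, x != 0 -> exists2 y, y \in K & x * y = 1}.

Definition finitely_generated_alg (K : {pred R}) : Prop :=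
  exists (k : nat) (g : 'I_k -> R),
    forall r : R, exists2 p : {mpoly R[k]}, p \is a mpolyOver k K & r = p.@[g].

Definition affine_domain : Prop :=
  finitely_generated_ring \/
  exists2 K : {pred R}, is_subfield K & finitely_generated_alg K.

End AffineDomains.

Section IdealPowers.
Variable R : comNzRingType.
Implicit Types I J : {pred R}.

(* [idealr_closed] ideals are proper by definition. *)
Definition is_maximal_ideal I : Prop :=
  idealr_closed I /\
  forall J, idealr_closed J -> {subset I <= J} -> J =i I.

Record max_ideal := MaxIdeal {
  max_ideal_pred :> {pred R};
  max_idealP : is_maximal_ideal max_ideal_pred }.

Definition ideal_mul I J : {pred R} := fun x => `[< exists s : seq (R * R),
  (forall u, u \in s -> u.1 \in I /\ u.2 \in J) /\
  x = \sum_(u <- s) u.1 * u.2 >].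

Definition ideal_exp I (k : nat) : {pred R} := iter k (ideal_mul I) predT.

Lemma ideal_mulS I J J' :
  {subset J <= J'} -> {subset ideal_mul I J <= ideal_mul I J'}.
Proof.
move=> sJ x /asboolP[s [Hs ->]]; apply/asboolP; exists s; split=> // u us.
by have [uI uJ] := Hs u us; split=> //; apply: sJ.
Qed.

Lemma ideal_expS I k : {subset ideal_exp I k.+1 <= ideal_exp I k}.
Proof. by elim: k => [|k IHk] // x; apply: ideal_mulS. Qed.

Lemma ideal_mul_closed I J : idealr_closed I -> idealr_closed (ideal_mul I J).
Proof.
case=> I0 I1 IM; split.
- by apply/asboolP; exists [::]; rewrite big_nil.
- apply: contra I1 => /asboolP[s [Hs ->]]; rewrite big_seq.
  apply: (big_ind (fun x => x \in I)) => // [x y xI yI|u us].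
    by rewrite -[x]mul1r IM.
  by rewrite mulrC -[_ * _]addr0 IM //; case: (Hs u us).
move=> a _ _ /asboolP[s [Hs ->]] /asboolP[t [Ht ->]]; apply/asboolP.
exists ([seq (a * u.1, u.2) | u <- s] ++ t); split; last first.
  rewrite big_cat big_map /= mulr_sumr; congr (_ + _).
  by apply: eq_bigr => u _; rewrite mulrA.
move=> u; rewrite mem_cat => /orP[/mapP[v vs ->]|/Ht //].
by have [vI vJ] := Hs v vs; split=> //=; rewrite -[_ * _]addr0 IM.
Qed.

End IdealPowers.

Section Completion.
Variables (R : comNzRingType) (m : max_ideal R).

HB.instance Definition _ :=
  isIdealr.Build R (max_ideal_pred m) (max_idealP m).1.

Definition residue_ring := {ideal_quot (max_ideal_pred m)}.

(* [adic_ideal k] is m^(k+1): [{ideal_quot _}] only accepts proper ideals, and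
   dropping R / m^0 = 0 does not change the inverse limit. *)
Definition adic_ideal (k : nat) : {pred R} := ideal_exp m k.+1.

Lemma adic_ideal_closed k : idealr_closed (adic_ideal k).
Proof. exact: ideal_mul_closed (max_idealP m).1. Qed.

HB.instance Definition _ k := isIdealr.Build R (adic_ideal k)
  (adic_ideal_closed k).

Definition adic_quot (k : nat) := {ideal_quot (adic_ideal k)}.
HB.instance Definition _ k := GRing.ComNzRing.on (adic_quot k).

Definition adic_proj (k : nat) (r : R) : adic_quot k :=
  \pi_({ideal_quot (adic_ideal k)})%qT r.

Definition adic_trans (k : nat) (x : adic_quot k.+1) : adic_quot k :=
  adic_proj k (repr x).

Lemma adic_proj_is_zmod_morphism k : zmod_morphism (adic_proj k).
Proof. exact: (raddfB (\pi_({ideal_quot (adic_ideal k)})%qT)). Qed.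
Lemma adic_proj_is_monoid_morphism k : monoid_morphism (adic_proj k).
Proof.
split; first exact: (rmorph1 (\pi_({ideal_quot (adic_ideal k)})%qT)).
exact: (rmorphM (\pi_({ideal_quot (adic_ideal k)})%qT)).
Qed.
HB.instance Definition _ k :=
  GRing.isZmodMorphism.Build _ _ (adic_proj k) (adic_proj_is_zmod_morphism k).
HB.instance Definition _ k :=
  GRing.isMonoidMorphism.Build _ _ (adic_proj k)
    (adic_proj_is_monoid_morphism k).

Lemma adic_proj_surj k (x : adic_quot k) : exists r, x = adic_proj k r.
Proof. by exists (repr x); rewrite /adic_proj reprK. Qed.

Lemma adic_projP k r s : (adic_proj k r = adic_proj k s) <-> (r - s \in adic_ideal k).
Proof. by rewrite Quotient.idealrBE; split=> [/eqP|/eqP]. Qed.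

Lemma adic_trans_proj k r : adic_trans (adic_proj k.+1 r) = adic_proj k r.
Proof.
apply/adic_projP; apply: ideal_expS.
apply: (@proj1 _ _ (@adic_projP k.+1 _ _)).
by rewrite /adic_proj reprK.
Qed.

Lemma adic_trans_is_zmod_morphism k : zmod_morphism (@adic_trans k).
Proof.
move=> x y; have [r ->] := adic_proj_surj x; have [s ->] := adic_proj_surj y.
by rewrite -rmorphB !adic_trans_proj rmorphB.
Qed.
Lemma adic_trans_is_monoid_morphism k : monoid_morphism (@adic_trans k).
Proof.
split=> [|x y]; first by rewrite -(rmorph1 (adic_proj k.+1)) adic_trans_proj rmorph1.
have [r ->] := adic_proj_surj x; have [s ->] := adic_proj_surj y.
by rewrite -rmorphM !adic_trans_proj rmorphM.
Qed.
HB.instance Definition _ k := GRing.isZmodMorphism.Build _ _ (@adic_trans k)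
  (@adic_trans_is_zmod_morphism k).
HB.instance Definition _ k := GRing.isMonoidMorphism.Build _ _ (@adic_trans k)
  (@adic_trans_is_monoid_morphism k).

Record completion := Completion {
  cproj : forall k, adic_quot k;
  cprojP : forall k, adic_trans (cproj k.+1) = cproj k }.

HB.instance Definition _ := gen_eqMixin completion.
HB.instance Definition _ := gen_choiceMixin completion.

Lemma completionP (x y : completion) :
  (forall k, cproj x k = cproj y k) -> x = y.
Proof.
case: x y => [x xP] [y yP] /= exy.
have {}exy : x = y by apply: functional_extensionality_dep.
by rewrite exy in xP *; congr Completion; apply: Prop_irrelevance.
Qed.

Fact czeroP k : adic_trans (0 : adic_quot k.+1) = 0.
Proof. exact: rmorph0. Qed.
Definition czero := Completion czeroP.

Fact coneP k : adic_trans (1 : adic_quot k.+1) = 1.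
Proof. exact: rmorph1. Qed.
Definition cone := Completion coneP.

Fact coppP (x : completion) k : adic_trans (- cproj x k.+1) = - cproj x k.
Proof. by rewrite rmorphN /= cprojP. Qed.
Definition copp x := Completion (coppP x).

Fact caddP (x y : completion) k :
  adic_trans (cproj x k.+1 + cproj y k.+1) = cproj x k + cproj y k.
Proof. by rewrite rmorphD /= !cprojP. Qed.
Definition cadd x y := Completion (caddP x y).

Fact cmulP (x y : completion) k :
  adic_trans (cproj x k.+1 * cproj y k.+1) = cproj x k * cproj y k.
Proof. by rewrite rmorphM /= !cprojP. Qed.
Definition cmul x y := Completion (cmulP x y).

Fact caddA : associative cadd.
Proof. by move=> x y z; apply: completionP => k; apply: addrA. Qed.
Fact caddC : commutative cadd.
Proof. by move=> x y; apply: completionP => k; apply: addrC. Qed.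
Fact cadd0 : left_id czero cadd.
Proof. by move=> x; apply: completionP => k; apply: add0r. Qed.
Fact caddN : left_inverse czero copp cadd.
Proof. by move=> x; apply: completionP => k; apply: addNr. Qed.
Fact cmulA : associative cmul.
Proof. by move=> x y z; apply: completionP => k; apply: mulrA. Qed.
Fact cmulC : commutative cmul.
Proof. by move=> x y; apply: completionP => k; apply: mulrC. Qed.
Fact cmul1 : left_id cone cmul.
Proof. by move=> x; apply: completionP => k; apply: mul1r. Qed.
Fact cmulD : left_distributive cmul cadd.
Proof. by move=> x y z; apply: completionP => k; apply: mulrDl. Qed.
Fact cone_neq0 : cone != czero.
Proof.
apply/eqP => /(congr1 (fun x => cproj x 0)) /= /eqP.
by apply/negP; apply: oner_neq0.
Qed.

HB.instance Definition _ :=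
  GRing.isZmodule.Build completion caddA caddC cadd0 caddN.
HB.instance Definition _ := GRing.Zmodule_isComNzRing.Build completion
  cmulA cmulC cmul1 cmulD cone_neq0.

Definition to_completion (r : R) : completion :=
  @Completion (adic_proj^~ r) (adic_trans_proj^~ r).

Lemma to_completion_is_zmod_morphism : zmod_morphism to_completion.
Proof. by move=> r s; apply: completionP => k; apply: rmorphB. Qed.
Lemma to_completion_is_monoid_morphism : monoid_morphism to_completion.
Proof.
split=> [|r s]; apply: completionP => k; first exact: rmorph1.
exact: rmorphM.
Qed.
HB.instance Definition _ := GRing.isZmodMorphism.Build R completion
  to_completion to_completion_is_zmod_morphism.
HB.instance Definition _ := GRing.isMonoidMorphism.Build R completion
  to_completion to_completion_is_monoid_morphism.

End Completion.

Definition finite_quotients (R : comNzRingType) : Prop :=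
  forall m : max_ideal R, finite_set [set: residue_ring m].

Definition poly_map (R A : comNzRingType) (n : nat) (iota : R -> A)
    (f : 'I_n -> {mpoly R[n]}) (a : 'I_n -> A) : 'I_n -> A :=
  fun i => mmap iota a (f i).

(* Main.v *)
Require Import Defs.
From HB Require Import structures.
From mathcomp Require Import all_boot all_order all_algebra.
From mathcomp Require Import boolp classical_sets cardinality.
From mathcomp Require Import mpoly.
From mathcomp Require Import all_field zify ring.

Set Implicit Arguments.
Unset Strict Implicit.
Unset Printing Implicit Defensive.

Import GRing.Theory.
Local Open Scope ring_scope.
Local Notation "x %:F" := (@FracField.tofrac _ x).

(** Each of the two surjectivity conditions implies that f is onto modulo m^k
    for every maximal ideal m and every k: for the second one because S(m)
    contains R and the completion of R at m maps onto R / m^k.  Conversely, if f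
    is onto modulo every m and every m^2, then it has a polynomial right inverse:
    there is g in R[y]^n with f(g(y)) = y ([polynomial_right_inverse]).  For any
    ring A over R and b in A^n, the tuple g(b) then solves f(a) = b, and it has
    its entries in every subring that contains R and the entries of b.  Both
    implications follow.

    Since R / m is finite for all m and R has characteristic zero, R contains no
    subfield, so R is finitely generated as a ring.  The right inverse is found
    in four stages.

    Finite places.  Finitely many elements of a field of characteristic zero
    always lie in a subring that has a homomorphism to some prime field F_p
    ([finite_place]).  Such a field is a simple algebraic extension of a purely
    transcendental one, so after specialising the transcendental variables to
    integers this amounts to finding a prime modulo which a given nonconstant
    integer polynomial has a root.  When the subring contains R, the induced map
    R -> F_p is onto, its kernel is maximal, and hence f is onto on F_p^n; this
    set being finite, f is bijective on it.  Every statement below about points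
    over large fields is contradicted at such a place.

    Rational inverse ([rational_inverse]).  Let K be the fraction field of R.
    The f_i are algebraically independent, since a relation P(f) = 0 would give
    P = 0 on all of F_p^n.  So K(x) is a finite extension of K(f), generated by
    one element z.  If z were not in K(f), a second root of its minimal
    polynomial would yield a point x' <> x with f(x') = f(x), and a finite place
    defined on the coordinates of x, of x' and on the inverse of some
    x'_i - x_i would contradict injectivity on F_p^n.  Hence x_i = A(f) / B(f).

    Polynomial inverse ([polynomial_inverse]).  Restrict A / B to the generic
    line through the origin, where one may assume B(0) <> 0.  A pole of the
    restriction at a point c would specialise to a point of F_p^n over which f
    has no preimage a, because the reduced form of x_i B(f) = A(f) reads
    a_i * 0 = nonzero there.  So the restriction is a polynomial in the
    parameter; as B(0) is a constant, its coefficients are polynomials too, and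
    s x_i = C(f) with C in R[y] and s in R nonzero.

    Denominators ([dvd_of_dvd_subst]).  Onto modulo m and m^2 forces the Jacobian
    determinant of f at 0 out of m, because m <> m^2 ([det_jacobian0_notin],
    [max_ideal_neq_square]).  So it is a unit of R, and comparing homogeneous
    components of lowest degree shows that C(f) divisible by s implies C
    divisible by s. *)

(** * Partial homomorphisms *)

(** A homomorphism from a subring of A to B, given by its graph: extensions and
    composites then need no choice of values, and being single-valued comes
    down to the values at 0. *)
Record partial_hom (A B : comNzRingType) (G : A -> B -> Prop) : Prop :=
  PartialHom {
    ph1 : G 1 1;
    phB : forall x x' y y', G x y -> G x' y' -> G (x - x') (y - y');
    phM : forall x x' y y', G x y -> G x' y' -> G (x * x') (y * y');
    ph0 : forall y, G 0 y -> y = 0 }.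

Section PartialHomTheory.
Variables (A B : comNzRingType) (G : A -> B -> Prop) (hG : partial_hom G).

Lemma ph00 : G 0 0.
Proof. by rewrite -{1}(subrr 1) -(subrr 1); apply: phB hG _ _ _ _ (ph1 hG) (ph1 hG). Qed.

Lemma phN x y : G x y -> G (- x) (- y).
Proof. by move=> h; rewrite -sub0r -[- y]sub0r; apply: phB hG _ _ _ _ ph00 h. Qed.

Lemma phD x x' y y' : G x y -> G x' y' -> G (x + x') (y + y').
Proof.
by move=> h h'; rewrite -[x']opprK -[y']opprK; apply: phB hG _ _ _ _ h (phN h').
Qed.

Lemma ph_fun x y y' : G x y -> G x y' -> y = y'.
Proof.
move=> h h'; apply/eqP; rewrite -subr_eq0; apply/eqP/(ph0 hG).
by rewrite -(subrr x); apply: phB hG _ _ _ _ h h'.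
Qed.

Lemma ph_sum (I : Type) (r : seq I) (P : pred I) (u : I -> A) (v : I -> B) :
  (forall i, P i -> G (u i) (v i)) ->
  G (\sum_(i <- r | P i) u i) (\sum_(i <- r | P i) v i).
Proof. by move=> h; elim/big_ind2: _ => //; [exact: ph00 | move=> *; apply: phD]. Qed.

Lemma ph_prod (I : Type) (r : seq I) (P : pred I) (u : I -> A) (v : I -> B) :
  (forall i, P i -> G (u i) (v i)) ->
  G (\prod_(i <- r | P i) u i) (\prod_(i <- r | P i) v i).
Proof. by move=> h; elim/big_ind2: _ => //; [exact: ph1 hG | move=> *; exact: (phM hG)]. Qed.

Lemma ph_exp x y k : G x y -> G (x ^+ k) (y ^+ k).
Proof.
move=> h; elim: k => [|k IH]; first by rewrite !expr0; exact: ph1 hG.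
by rewrite !exprS; apply: (phM hG).
Qed.

Lemma ph_nat k : G k%:R k%:R.
Proof.
elim: k => [|k IH]; first exact: ph00.
by rewrite -(addn1 k) !natrD; apply: phD IH (ph1 hG).
Qed.

Lemma ph_int (z : int) : G z%:~R z%:~R.
Proof. case: z => k; first exact: ph_nat.
by rewrite NegzE !mulrNz -!pmulrn; apply: phN; exact: ph_nat. Qed.

Definition poly_rel (P : {poly A}) (Q : {poly B}) := forall i, G P`_i Q`_i.

Lemma poly_rel_partial_hom : partial_hom poly_rel.
Proof.
split=> [i|P P' Q Q' h h' i|P P' Q Q' h h' i|Q h].
- by rewrite !coef1; exact: ph_nat.
- by rewrite !coefB; apply: (phB hG).
- by rewrite !coefM; apply: ph_sum => k _; apply: (phM hG).
by apply/polyP=> i; have := h i; rewrite !coef0 => /(ph0 hG).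
Qed.

Lemma poly_relC x y : G x y -> poly_rel x%:P y%:P.
Proof. by move=> h [|i]; rewrite !coefC //=; exact: ph00. Qed.

Lemma poly_relX : poly_rel 'X 'X.
Proof. by move=> i; rewrite !coefX; exact: ph_nat. Qed.

Lemma ph_horner P Q x y : poly_rel P Q -> G x y -> G P.[x] Q.[y].
Proof.
move=> h hxy; pose k := maxn (size P) (size Q).
rewrite (@horner_coef_wide _ k) ?leq_maxl // (@horner_coef_wide _ k) ?leq_maxr //.
by apply: ph_sum => i _; apply: (phM hG) => //; apply: ph_exp.
Qed.

Lemma poly_rel_exists (P : {poly A}) :
  (forall i, exists y, G P`_i y) -> exists Q, poly_rel P Q /\ (size Q <= size P)%N.
Proof.
move=> /choice[g hg]; exists (\poly_(i < size P) g i); split; last exact: size_poly.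
move=> i; rewrite coef_poly; case: ltnP => // hi.
by rewrite nth_default //; exact: ph00.
Qed.

Lemma ph_mmap (R : comNzRingType) n (j : {rmorphism R -> A})
    (r : {rmorphism R -> B}) (u : 'I_n -> A) (v : 'I_n -> B) (W : {mpoly R[n]}) :
  (forall c, G (j c) (r c)) -> (forall i, G (u i) (v i)) ->
  G (mmap j u W) (mmap r v W).
Proof.
move=> hjr huv; rewrite /mmap; apply: ph_sum => m _; apply: (phM hG) => //.
by apply: ph_prod => i _; apply: ph_exp.
Qed.

(** Putting the inverse of an element in the domain of a partial homomorphism
    is the way to keep its value from vanishing. *)
Lemma ph_neq0 x y z : x * z = 1 -> G x y -> (exists t, G z t) -> y != 0.
Proof.
move=> xz hxy [t hzt]; apply/eqP => y0.
have := ph_fun (ph1 hG) _ => /(_ (y * t)); rewrite -xz => /(_ (phM hG hxy hzt)).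
by rewrite y0 mul0r; apply/eqP; exact: oner_neq0.
Qed.

End PartialHomTheory.

Lemma comp_partial_hom (A B C : comNzRingType) (G : A -> B -> Prop)
    (H : B -> C -> Prop) :
  partial_hom G -> partial_hom H ->
  partial_hom (fun x z => exists2 y, G x y & H y z).
Proof.
move=> hG hH; split.
- by exists 1; [exact: ph1 hG | exact: ph1 hH].
- move=> x x' z z' [y xy yz] [y' xy' yz'].
  by exists (y - y'); [apply: (phB hG) | apply: (phB hH)].
- move=> x x' z z' [y xy yz] [y' xy' yz'].
  by exists (y * y'); [apply: (phM hG) | apply: (phM hH)].
by move=> z [y /(ph0 hG) -> /(ph0 hH)].
Qed.

Lemma graph_partial_hom (A B : comNzRingType) (h : {rmorphism A -> B}) :
  partial_hom (fun x y => y = h x).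
Proof.
by split=> [|x x' y y' -> ->|x x' y y' -> ->|y ->]; rewrite ?rmorph1 ?rmorphB ?rmorphM ?rmorph0.
Qed.

(** The extension of h to the localisation of A at the kernel of h, viewed inside
    K. *)
Lemma frac_partial_hom (A : idomainType) (K B : fieldType)
    (j : {rmorphism A -> K}) (h : {rmorphism A -> B}) :
  injective j ->
  partial_hom (fun x y => exists a b,
    [/\ h b != 0, x = j a / j b & y = h a / h b]).
Proof.
move=> injj.
have jn0 b : h b != 0 -> j b != 0.
  by apply: contraNneq; rewrite -(rmorph0 j) => /injj ->; rewrite rmorph0.
split.
- by exists 1, 1; rewrite !rmorph1 divr1 oner_neq0 divr1.
- move=> x x' y y' [a [b [hb -> ->]]] [a' [b' [hb' -> ->]]].
  exists (a * b' - a' * b), (b * b'); rewrite !rmorphM mulf_neq0 //.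
  split=> //; rewrite -mulNr addf_div ?jn0 // !rmorphB !rmorphM ?mulNr //.
- move=> x x' y y' [a [b [hb -> ->]]] [a' [b' [hb' -> ->]]].
  exists (a * a'), (b * b'); rewrite !rmorphM mulf_neq0 //.
  by rewrite !invfM; split=> //; rewrite mulrACA.
move=> y [a [b [hb /esym/eqP]]]; rewrite mulf_eq0 invr_eq0 (negPf (jn0 _ hb)) orbF.
by rewrite -(rmorph0 j) => /eqP/injj -> ->; rewrite rmorph0 mul0r.
Qed.

(** * Fraction fields and integer polynomials modulo primes *)

Section FractionLift.
Variables (A : idomainType) (L : fieldType) (j : {rmorphism A -> L}).
Hypothesis injj : injective j.
Local Notation F := (@FracField.tofrac A).

Lemma frac_reprE (x : {fraction A}) : x = F \n_(repr x) / F \d_(repr x).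
Proof.
have d0 := denom_ratioP (repr x).
apply: (canRL (mulfK _)); first by rewrite tofrac_eq0.
rewrite -{1}[x]reprK.
have piM (u v : {ratio A}) : (\pi_({fraction A})%qT u) * (\pi_({fraction A})%qT v)
   = \pi_({fraction A})%qT (FracField.mulf u v).
  by rewrite [LHS]/GRing.mul /= -FracField.pi_mul.
have FE a : F a = \pi_({fraction A})%qT (Ratio a 1).
  by rewrite /FracField.tofrac; unlock.
rewrite !FE piM; apply/eqmodP => /=; rewrite /FracField.equivf /FracField.mulf /=.
by rewrite !numden_Ratio ?oner_neq0 ?mulf_neq0 ?mulr1 ?oner_neq0 // mulrC.
Qed.

Lemma fracE (x : {fraction A}) : exists a b, b != 0 /\ x = F a / F b.
Proof.
by exists (\n_(repr x)), (\d_(repr x)); rewrite denom_ratioP -frac_reprE.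
Qed.

Definition frac_lift (x : {fraction A}) : L := j (\n_(repr x)) / j (\d_(repr x)).

Let j0 b : b != 0 -> j b != 0.
Proof. by apply: contraNneq; rewrite -(rmorph0 j) => /injj ->. Qed.

Lemma frac_liftE a b : b != 0 -> frac_lift (F a / F b) = j a / j b.
Proof.
move=> b0; rewrite /frac_lift; set x := F a / F b.
have := frac_reprE x; rewrite {1}/x => /eqP.
have d0 := denom_ratioP (repr x).
rewrite eqr_div ?tofrac_eq0 // -!rmorphM tofrac_eq => /eqP e.
by apply/eqP; rewrite eqr_div ?j0 // -!rmorphM e.
Qed.

Lemma frac_lift_exists :
  exists J : {rmorphism {fraction A} -> L}, forall a, J (F a) = j a.
Proof.
have zm : zmod_morphism frac_lift.
  move=> x y; have [a [b [b0 ->]]] := fracE x; have [c [d [d0 ->]]] := fracE y.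
  rewrite -mulNr addf_div ?tofrac_eq0 // -rmorphN -!rmorphM -rmorphD.
  by rewrite !frac_liftE ?mulf_neq0 // -mulNr addf_div ?j0 // rmorphD !rmorphM rmorphN.
have mm : monoid_morphism frac_lift.
  split; first by rewrite -(divr1 1) -(rmorph1 F) frac_liftE ?oner_neq0 // rmorph1 divr1.
  move=> x y; have [a [b [b0 ->]]] := fracE x; have [c [d [d0 ->]]] := fracE y.
  rewrite mulf_div -!rmorphM !frac_liftE ?mulf_neq0 // !rmorphM mulf_div //.
pose J1 := GRing.isZmodMorphism.Build _ _ _ zm.
pose J2 := GRing.isMonoidMorphism.Build _ _ _ mm.
pose J : {rmorphism {fraction A} -> L} := HB.pack frac_lift J1 J2.
exists J => a /=; rewrite -[F a]divr1 -(rmorph1 F) frac_liftE ?oner_neq0 //.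
by rewrite rmorph1 divr1.
Qed.

End FractionLift.

(** In characteristic zero the natural numbers are infinitely many candidates. *)
Lemma nat_nonroot (F : idomainType) (P : {poly F}) :
  [pchar F] =i pred0 -> P != 0 -> exists k : nat, P.[k%:R] != 0.
Proof.
move=> c0 P0; apply: contrapT => h.
have hr k : root P k%:R by apply: contraT => hk; case: h; exists k.
pose rs : seq F := [seq k%:R | k <- iota 0 (size P)].
suff U : uniq rs.
  have /(max_poly_roots P0)/(_ U) : all (root P) rs.
    by apply/allP => _ /mapP[k _ ->].
  by rewrite size_map size_iota ltnn.
rewrite map_inj_uniq ?iota_uniq // => k l /eqP.
wlog lekl : k l / (k <= l)%N.
  by move=> H; case/orP: (leq_total k l) => hkl e; [|symmetry]; apply: H => //; rewrite eq_sym.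
move/pcharf0P: c0 => c0.
rewrite eq_sym -subr_eq0 -natrB // c0 subn_eq0 => lelk.
by apply/eqP; rewrite eqn_leq lekl.
Qed.

(** Euclid's argument.  If a = H(0) is nonzero, then
    H(M a z) = a (1 + M q) for some integer q, and the second factor is prime to
    M; it differs from 1 and -1 for a suitable z, since H(M a z) takes the values
    a and -a only finitely often. *)
Lemma int_poly_root_mod (H : {poly int}) (M : int) : (1 < size H)%N -> M != 0 ->
  exists p (c : int), [/\ prime p, ~~ (p %| M)%Z & (p %| H.[c])%Z].
Proof.
move=> sH M0.
have zero_case c : H.[c] = 0 -> exists p (c : int), [/\ prime p, ~~ (p %| M)%Z & (p %| H.[c])%Z].
  move=> Hc; have [p Mp pp] := prime_above `|M|%N; exists p, c; split=> //.
    rewrite dvdzE /=; apply/negP => /dvdn_leq; rewrite absz_gt0 M0 => /(_ isT).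
    by rewrite leqNgt Mp.
  by rewrite Hc dvdz0.
have [/zero_case //|H0] := eqVneq H.[0] 0.
set a := H.[0] in H0.
pose H2 := H \Po ((M * a) *: 'X).
have sl : size ((M * a) *: 'X : {poly int}) = 2.
  by rewrite size_scale ?size_polyX // mulf_neq0.
have sH2 : size H2 = size H.
  rewrite /H2; have := size_comp_poly H ((M * a) *: 'X).
  rewrite sl muln1 => e; have: (1 < size H)%N by [].
  have : (0 < size H2)%N.
    rewrite lt0n size_poly_eq0 /H2 comp_poly_eq0 ?sl // -size_poly_eq0.
    by case: (size H) sH.
  by case: (size _) e => // k; case: (size H) sH => // l _ /= ->.
have nz e : H2 + e%:P != 0.
  apply: contraTneq sH => /eqP; rewrite addr_eq0 -sH2 => /eqP ->.
  by rewrite -polyCN -leqNgt size_polyC_leq1.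
have [z] : exists z : nat, ((H2 + (- a)%:P) * (H2 + a%:P)).[z%:R] != 0.
  by apply: nat_nonroot; [exact: Num.Theory.pchar_num | rewrite mulf_neq0].
rewrite hornerM !hornerD !hornerC mulf_eq0 negb_or subr_eq0 addr_eq0 => /andP[za zNa].
set x := M * a * z%:R.
have e2 : H2.[z%:R] = H.[x] by rewrite /H2 horner_comp hornerZ hornerX.
have [q Hq] : exists q, H.[x] = a * (1 + M * q).
  have /factor_theorem[S HS] : root (H - a%:P) 0 by rewrite rootE !hornerE subrr.
  exists (z%:R * S.[x]).
  have -> : H = S * 'X + a%:P by apply/eqP; rewrite -subr_eq HS subr0.
  by rewrite hornerD hornerM hornerX hornerC /x; ring.
rewrite e2 Hq in za zNa.
have [u0|u0] := eqVneq (1 + M * q) 0; first by apply: (zero_case x); rewrite Hq u0 mulr0.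
move: za zNa u0 Hq; set u : int := 1 + M * q => za zNa u0 Hq.
have u1 : (1 < `|u|)%N.
  rewrite ltn_neqAle absz_gt0 u0 andbT eq_sym.
  move: za zNa; clear; case: u => [[|[|k]]|[|k]] //; first by rewrite mulr1 eqxx.
  by rewrite (_ : Negz 0 = -1) // mulrN1 eqxx.
exists (pdiv `|u|), x; split; first exact: pdiv_prime.
  apply/negP => pM; have : (pdiv `|u|%N %| 1)%Z.
    have -> : 1 = u - M * q :> int by rewrite addrK.
    by rewrite rpredB ?dvdz_mulr // dvdzE pdiv_dvd.
  by rewrite dvdz1 /= => /eqP e; have := prime_gt1 (pdiv_prime u1); rewrite e.
by rewrite Hq dvdz_mull // dvdzE pdiv_dvd.
Qed.

(** * Places of purely transcendental extensions *)

(** Finite places extend to simple algebraic extensions of F as soon as the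
    reduction of the minimal polynomial of a generator acquires a root; this
    property of F provides the two at once, and passes from F to F(t). *)
Definition residually_rooted (F : fieldType) : Prop :=
  forall (g : seq F) (h : {poly F}), h \is monic -> (1 < size h)%N ->
  exists p (G : F -> 'F_p -> Prop),
    [/\ prime p, partial_hom G, forall x, x \in g -> exists y, G x y &
     exists Q t, poly_rel G h Q /\ root Q t].

Lemma common_denominator (A : idomainType) (s : seq {fraction A}) :
  exists2 d : A, d != 0 & forall x, x \in s -> exists a, x = a%:F / d%:F.
Proof.
elim: s => [|x s [d d0 hd]]; first by exists 1; rewrite ?oner_neq0.
have [a [b [b0 ->]]] := fracE x.
exists (b * d); first by rewrite mulf_neq0.
have F0 (c : A) : c != 0 -> c%:F != 0 by rewrite tofrac_eq0.
move=> y; rewrite inE => /predU1P[->|/hd[c ->]].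
  by exists (a * d); rewrite !rmorphM -mulf_div divff ?mulr1 ?F0.
by exists (b * c); rewrite !rmorphM -mulf_div divff ?mul1r ?F0.
Qed.

Lemma residually_rooted_Q : residually_rooted {fraction int}.
Proof.
move=> g h hm sh; have [d d0 hd] := common_denominator (g ++ h).
have dF0 : d%:F != 0 :> {fraction int} by rewrite tofrac_eq0.
have /choice[u hu] : forall i, exists a : int, h`_i = a%:F / d%:F.
  move=> i; case: (ltnP i (size h)) => hi.
    by apply: hd; rewrite mem_cat mem_nth ?orbT.
  by exists 0; rewrite nth_default // rmorph0 mul0r.
pose H := \poly_(i < size h) u i.
have sH : (1 < size H)%N.
  rewrite size_poly_eq // -(tofrac_eq0 (u _)).
  have /eqP := hu (size h).-1; rewrite -lead_coefE (monicP hm).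
  by apply: contraTneq => ->; rewrite mul0r oner_neq0.
have [p [c [pp pd pH]]] := int_poly_root_mod sH d0.
have pc := pchar_Fp pp.
exists p, (fun x y => exists a b : int,
  [/\ b%:~R != 0 :> 'F_p, x = a%:F / b%:F & y = a%:~R / b%:~R]).
have dp : d%:~R != 0 :> 'F_p by rewrite -(dvdz_pcharf pc).
split=> //.
- by apply: (@frac_partial_hom _ _ _ (@FracField.tofrac int) intr) => x y /eqP; rewrite tofrac_eq => /eqP.
- move=> x xg; have [|a ->] := hd x; first by rewrite mem_cat xg.
  by exists (a%:~R / d%:~R), a, d.
exists (d%:~R^-1 *: map_poly intr H), c%:~R; split.
  move=> i; exists H`_i, d; split=> //; last first.
    by rewrite coefZ coef_map /= mulrC.
  rewrite coef_poly; case: ltnP => hi; first exact: hu.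
  by rewrite nth_default // rmorph0 mul0r.
by rewrite rootE hornerZ horner_map /= mulf_eq0 -[X in _ || X](dvdz_pcharf pc) pH orbT.
Qed.

(** The variable is specialised to an integer that is not a root of a common
    denominator of the data; h stays monic of the same degree. *)
Lemma residually_rooted_fraction (F : fieldType) : [pchar F] =i pred0 ->
  residually_rooted F -> residually_rooted {fraction {poly F}}.
Proof.
move=> c0 hF g h hm sh; have [d d0 hd] := common_denominator (g ++ h).
have [k dk] := nat_nonroot c0 d0.
pose ev : {poly F} -> F := horner_eval (k%:R : F).
pose G1 (x : {fraction {poly F}}) (y : F) := exists a b : {poly F},
  [/\ ev b != 0, x = a%:F / b%:F & y = ev a / ev b].
have hG1 : partial_hom G1.
  by apply: frac_partial_hom => x y /eqP; rewrite tofrac_eq => /eqP.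
have dom x : x \in g ++ h -> exists y, G1 x y.
  by move=> /hd[a ->]; exists (ev a / ev d), a, d.
have [h1 [hh1 sh1]] : exists Q, poly_rel G1 h Q /\ (size Q <= size h)%N.
  apply: poly_rel_exists => // i; case: (ltnP i (size h)) => hi.
    by apply: dom; rewrite mem_cat mem_nth ?orbT.
  by rewrite nth_default //; exists 0; apply: ph00.
have lc : h1`_(size h).-1 = 1.
  have := hh1 (size h).-1; rewrite -lead_coefE (monicP hm) => e.
  exact: (ph_fun hG1 e (ph1 hG1)).
have sE : size h1 = size h.
  apply/eqP; rewrite eqn_leq sh1 /=; case: (size h) sh lc => // m _ lc.
  by rewrite ltnNge; apply/negP => sm; move: lc; rewrite nth_default // => /esym/eqP; rewrite oner_eq0.
have h1m : h1 \is monic by rewrite monicE lead_coefE sE lc.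
have /choice[v hv] : forall x, exists y, x \in g -> G1 x y.
  move=> x; case: (boolP (x \in g)) => xg; last by exists 0.
  by have [|y hy] := dom x; [rewrite mem_cat xg | exists y].
have [|p [G2 [pp hG2 hg [Q [t [hQ rt]]]]]] := hF [seq v x | x <- g] h1 h1m.
  by rewrite sE.
exists p, (fun x z => exists2 y, G1 x y & G2 y z); split=> //.
- exact: comp_partial_hom.
- move=> x xg; have [|z hz] := hg (v x); first exact: map_f.
  by exists z, (v x) => //; apply: hv.
by exists Q, t; split=> // i; exists h1`_i.
Qed.

(** A transcendence basis is picked among the given elements one at a time: an
    element algebraic over the current field F changes nothing, a transcendental
    one replaces F by F(t). *)
Lemma residually_rooted_base (L : fieldType) (g : seq L) : [pchar L] =i pred0 ->
  exists (F : fieldType) (iota : {rmorphism F -> L}),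
    residually_rooted F /\ forall x, x \in g -> algebraicOver iota x.
Proof.
move=> c0; elim: g => [|x g [F [iota [hF hg]]]].
  have inji : injective (intr : int -> L).
    apply/raddf_inj => m e; have /eqP : m%:~R = 0 :> L by []; move/pcharf0P: c0 => c0.
    by case: m {e} => m; rewrite ?NegzE ?mulrNz ?oppr_eq0 -pmulrn c0 => /eqP -> //.
  have [J _] := frac_lift_exists inji.
  by exists {fraction int}, J; split=> //; exact: residually_rooted_Q.
have [ax|nax] := pselect (algebraicOver iota x).
  by exists F, iota; split=> // y; rewrite inE => /predU1P[->|/hg].
pose ev : {rmorphism {poly F} -> L} := horner_eval x \o map_poly iota.
have injev : injective ev.
  apply: raddf_inj => P e; apply/eqP; apply: contra_notT nax => P0.
  by exists P => //; apply/eqP.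
have [J JE] := frac_lift_exists injev.
have c0F : [pchar F] =i pred0 by move=> p; rewrite -(fmorph_pchar iota).
exists {fraction {poly F}}, J; split; first exact: residually_rooted_fraction.
have cJ c : J (c%:P)%:F = iota c.
  by rewrite JE /ev /= map_polyC /= /horner_eval hornerC.
move=> y; rewrite inE => /predU1P[->|/hg[P P0 Py]].
  exists ('X - ('X)%:F%:P); first by rewrite polyXsubC_eq0.
  rewrite rmorphB /= map_polyX map_polyC /= JE /ev /= map_polyX /horner_eval hornerX.
  by rewrite root_XsubC.
pose c' : {rmorphism F -> {fraction {poly F}}} := @FracField.tofrac _ \o polyC.
exists (map_poly c' P); first by rewrite map_poly_eq0.
rewrite -map_poly_comp; move: Py; congr (is_true (root _ _)).
by apply: eq_map_poly => c /=; rewrite cJ.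
Qed.

(** * Finite places of fields of characteristic zero *)

Section Algebraic.
Variables (F L : fieldType) (iota : {rmorphism F -> L}).
Local Notation "P ^i" := (map_poly iota P) (at level 2, format "P ^i").

Lemma minimal_polynomial (z : L) : algebraicOver iota z ->
  exists N : {poly F}, [/\ N \is monic, root N^i z &
    forall P, root P^i z -> N %| P].
Proof.
move=> [P0 nzP0 rP0].
pose Q k := `[< exists P : {poly F}, [/\ P != 0, root P^i z & size P = k] >].
have exQ : exists k, Q k by exists (size P0); apply/asboolP; exists P0.
case: (ex_minnP exQ) => k /asboolP[N [nzN rN sN]] mink.
exists ((lead_coef N)^-1 *: N); split.
- by rewrite monicE lead_coefZ mulVf ?lead_coef_eq0.
- by rewrite map_polyZ rootZ // fmorph_eq0 invr_eq0 lead_coef_eq0.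
move=> P rP; rewrite dvdpZl ?invr_eq0 ?lead_coef_eq0 //.
apply/modp_eq0P/eqP; apply: contraT => nz.
have : (k <= size (P %% N)%R)%N.
  apply: mink; apply/asboolP; exists (P %% N); split=> //.
  have -> : P %% N = P - P %/ N * N by rewrite {2}(divp_eq P N) [_ + P %% N]addrC addrK.
  by rewrite rootE rmorphB rmorphM !hornerE (eqP rP) (eqP rN) mulr0 subrr.
by rewrite leqNgt -sN ltn_modp nzN.
Qed.

Lemma primitive_element (g : seq L) : [pchar F] =i pred0 ->
  (forall x, x \in g -> algebraicOver iota x) ->
  exists2 z, algebraicOver iota z & forall x, x \in g -> exists q, x = q^i.[z].
Proof.
move=> c0; elim: g => [_|x g IH hg].
  by exists 0 => //; apply: algebraic0.
have [|z az hz] := IH; first by move=> y yg; apply: hg; rewrite inE yg orbT.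
have ax : algebraicOver iota x by apply: hg; rewrite inE eqxx.
case: (ax) (az) => [P P0 Px] [Q Q0 Qz].
have [k [[qx hqx] [qz hqz]]] := pchar0_PET P0 Px Q0 Qz c0.
exists (z *+ k - x); last first.
  move=> y; rewrite inE => /predU1P[->|/hz[q ->]]; first by exists qx.
  by exists (q \Po qz); rewrite map_comp_poly horner_comp hqz.
apply: algebraic_sub => //; elim: (k) => [|l IHl]; first exact: algebraic0.
by rewrite mulrS; apply: algebraic_add.
Qed.

Variables (B : comNzRingType) (G : F -> B -> Prop) (hG : partial_hom G).

(** The value of P(z) is P'(t), where P' is an image of P.  This is well defined
    because P(z) = 0 makes P a multiple of the monic N, and the long division of P
    by N never leaves the domain of G, so that P' is a multiple of N'. *)
Lemma algebraic_partial_hom (z : L) (N : {poly F}) (N' : {poly B}) (t : B) :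
  N \is monic -> (forall P, root P^i z -> N %| P) ->
  poly_rel G N N' -> root N' t ->
  partial_hom (fun x y => exists P P',
    [/\ poly_rel G P P', x = P^i.[z] & y = P'.[t]]).
Proof.
move=> mN minN hN rt; have hP := poly_rel_partial_hom hG.
split.
- by exists 1, 1; rewrite rmorph1 !hornerC; split=> //; exact: (ph1 hP).
- move=> x x' y y' [P [P' [h -> ->]]] [Q [Q' [h' -> ->]]].
  exists (P - Q), (P' - Q'); rewrite rmorphB !hornerD !hornerN.
  by split=> //; exact: (phB hP h h').
- move=> x x' y y' [P [P' [h -> ->]]] [Q [Q' [h' -> ->]]].
  exists (P * Q), (P' * Q'); rewrite rmorphM !hornerM.
  by split=> //; exact: (phM hP h h').
move=> y [P [P' [h /esym/eqP/minN NP ->]]]; apply/eqP; rewrite -/(root _ _).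
have [k] := ubnP (size P); elim: k P P' h NP => // k IH P P' h NP sP.
have [P0|P0] := eqVneq P 0.
  by move: h; rewrite P0 => /(ph0 hP) ->; rewrite root0.
have sN := dvdp_leq P0 NP; have N0 := monic_neq0 mN.
pose e := (size P - size N)%N; pose c := lead_coef P.
have hc : G c P'`_(size P).-1 by rewrite /c lead_coefE.
set c' := P'`_ _ in hc.
have hM : poly_rel G (c%:P * 'X^e * N) (c'%:P * 'X^e * N').
  have hX := ph_exp hP e (poly_relX hG).
  exact: (phM hP (phM hP (poly_relC hG hc) hX) hN).
suff : root (P' - c'%:P * 'X^e * N') t.
  by rewrite !rootE !hornerE (eqP rt) mulr0 subr0.
apply: (IH (P - c%:P * 'X^e * N)); first exact: (phB hP h hM).
  by rewrite dvdp_sub // dvdp_mull.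
apply: leq_trans (_ : size P <= k)%N; last by rewrite -ltnS.
have szP : (0 < size P)%N by rewrite lt0n size_poly_eq0.
have szN : (0 < size N)%N by rewrite lt0n size_poly_eq0.
rewrite -(ltn_predK szP) ltnS; apply/leq_sizeP => i hi.
rewrite coefB -mulrA coefCM coefXnM ltnNge (leq_trans _ hi) /=; last first.
  by rewrite /e -subn1 leq_sub2l.
have [eqi|nei] := eqVneq i (size P).-1.
  rewrite eqi -lead_coefE.
  have -> : ((size P).-1 - e = (size N).-1)%N.
    by rewrite /e -!subn1 subnAC subnBA // addKn.
  by rewrite -lead_coefE (monicP mN) mulr1 subrr.
have Pi : (size P <= i)%N.
  by rewrite -(ltn_predK szP) ltn_neqAle eq_sym nei.
rewrite [P`_i]nth_default // [N`_(i - e)]nth_default ?mulr0 ?subrr //.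
by rewrite leq_subRL ?subnK //; rewrite (leq_trans (leq_subr _ _) Pi).
Qed.
End Algebraic.

(** The given elements are polynomials in one algebraic generator over a purely
    transcendental field, to which [residually_rooted] is applied with the
    minimal polynomial of that generator. *)
Theorem finite_place (L : fieldType) (g : seq L) : [pchar L] =i pred0 ->
  exists p (G : L -> 'F_p -> Prop),
    [/\ prime p, partial_hom G & forall x, x \in g -> exists y, G x y].
Proof.
move=> c0; have [F [iota [hF ag]]] := residually_rooted_base g c0.
have c0F : [pchar F] =i pred0 by move=> p; rewrite -(fmorph_pchar iota).
have [z az hz] := primitive_element c0F ag.
have [N [mN rN minN]] := minimal_polynomial az.
have sN : (1 < size N)%N.
  rewrite ltnNge; apply/negP => /size1_polyC eN; move: mN rN.
  rewrite eN monicE lead_coefC => /eqP ->.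
  by rewrite rmorph1 rootE hornerC oner_eq0.
have /choice[q hq] : forall x, exists q, x \in g -> x = (map_poly iota q).[z].
  move=> x; case: (boolP (x \in g)) => [/hz[q ->]|_]; first by exists q.
  by exists 0.
have [p [G [pp hG hdom [Q [t [hQ rt]]]]]] :=
  hF (flatten [seq polyseq (q x) | x <- g]) N mN sN.
exists p, (fun x y => exists P P',
    [/\ poly_rel G P P', x = (map_poly iota P).[z] & y = P'.[t]]).
split=> //; first exact: algebraic_partial_hom hQ rt.
move=> x xg; have [|Q' [hQ' _]] := @poly_rel_exists _ _ _ hG (q x).
  move=> i; case: (ltnP i (size (q x))) => hi; last first.
    by rewrite nth_default //; exists 0; apply: ph00.
  apply: hdom; apply/flattenP; exists (polyseq (q x)); last exact: mem_nth.
  exact: (map_f (fun x => polyseq (q x))).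
by exists Q'.[t], (q x), Q'; split=> //; exact: hq.
Qed.

(** The images of generators of R are added to the list; their values determine
    a homomorphism on all of R. *)
Lemma finite_place_over (R : idomainType) (L : fieldType)
    (j : {rmorphism R -> L}) (g : seq L) :
  finitely_generated_ring R -> [pchar R] =i pred0 -> injective j ->
  exists p (r : {rmorphism R -> 'F_p}) (G : L -> 'F_p -> Prop),
    [/\ prime p, partial_hom G, forall c, G (j c) (r c) &
     forall x, x \in g -> exists y, G x y].
Proof.
move=> [k [a ha]] c0 injj.
have c0L : [pchar L] =i pred0.
  apply/pcharf0P => m; move/pcharf0P: c0 => <-.
  by rewrite -(rmorph_nat j) -(rmorph0 j) (inj_eq injj).
have [p [G [pp hG hdom]]] := finite_place (g ++ [seq j (a i) | i : 'I_k]) c0L.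
have /choice[r hr] : forall c, exists y, G (j c) y.
  have /choice[b hb] : forall i, exists y, G (j (a i)) y.
    by move=> i; apply: hdom; rewrite mem_cat; apply/orP; right; apply/mapP; exists i; rewrite // mem_enum.
  move=> c; have [P ->] := ha c; exists (mmap intr b P).
  have -> : j (mmap intr a P) = mmap intr (fun i => j (a i)) P.
    rewrite /mmap rmorph_sum; apply: eq_bigr => m _; rewrite rmorphM rmorph_int.
    by rewrite rmorph_prod; congr (_ * _); apply: eq_bigr => i _; rewrite rmorphXn.
  by apply: (ph_mmap hG) => // z; apply: ph_int.
have rB : zmod_morphism r.
  move=> x y; apply: (ph_fun hG (hr _)); rewrite rmorphB; exact: (phB hG).
have rM : monoid_morphism r.
  split; first by apply: (ph_fun hG (hr _)); rewrite rmorph1; exact: (ph1 hG).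
  by move=> x y; apply: (ph_fun hG (hr _)); rewrite rmorphM; exact: (phM hG).
pose r1 := GRing.isZmodMorphism.Build _ _ _ rB.
pose r2 := GRing.isMonoidMorphism.Build _ _ _ rM.
pose r' : {rmorphism R -> 'F_p} := HB.pack r r1 r2.
by exists p, r', G; split=> // x xg; apply: hdom; rewrite mem_cat xg.
Qed.

(** * Substitution in polynomials and algebraic dependence *)

Lemma eq_mmap n (R S : comNzRingType) (r r' : R -> S) (u u' : 'I_n -> S) (P : {mpoly R[n]}) :
  r =1 r' -> u =1 u' -> mmap r u P = mmap r' u' P.
Proof. by move=> er eu; apply: eq_bigr => m _; rewrite er (mmap1_eq _ eu). Qed.

Lemma rmorph_mmap n (R S T : comNzRingType) (s : {rmorphism S -> T})
    (r : R -> S) (u : 'I_n -> S) (P : {mpoly R[n]}) :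
  s (mmap r u P) = mmap (s \o r) (s \o u) P.
Proof.
rewrite /mmap rmorph_sum; apply: eq_bigr => m _; rewrite rmorphM.
by rewrite rmorph_prod; congr (_ * _); apply: eq_bigr => i _; rewrite rmorphXn.
Qed.

Lemma mmap_mpolyX n (R : comNzRingType) (P : {mpoly R[n]}) :
  mmap (@mpolyC n R) (fun i => 'X_i) P = P.
Proof.
rewrite /mmap [RHS]mpolyE; apply: eq_bigr => m _.
by rewrite mmap1_id mul_mpolyC.
Qed.

Lemma mmap1Ui n (R S : comNzRingType) (r : {rmorphism R -> S}) (u : 'I_n -> S) i :
  mmap r u 'X_i = u i.
Proof. by rewrite mmapX mmap1U. Qed.

Lemma mmap_mmap n m (R S T : comNzRingType) (r : {rmorphism S -> T})
    (s : R -> S) (a : 'I_n -> T) (g : 'I_m -> {mpoly S[n]}) (P : {mpoly R[m]}) :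
  mmap r a (mmap (fun c => (s c)%:MP) g P) =
  mmap (fun c => r (s c)) (fun i => mmap r a (g i)) P.
Proof. by rewrite rmorph_mmap; apply: eq_mmap => // c /=; rewrite mmapC. Qed.

Lemma mmap1_scale n (B : comNzRingType) (t : B) (v : 'I_n -> B) m :
  mmap1 (fun i => t * v i) m = t ^+ mdeg m * mmap1 v m.
Proof.
by rewrite /mmap1 mdegE -prodrXr -big_split; apply: eq_bigr => i _; exact: exprMn.
Qed.

Section Dependence.
Variables (n : nat) (R : idomainType).
Implicit Types p q : {mpoly R[n]}.

Lemma msizeM_leS p q d e :
  (msize p <= d.+1)%N -> (msize q <= e.+1)%N -> (msize (p * q) <= (d + e).+1)%N.
Proof.
have [->|p0] := eqVneq p 0; first by rewrite mul0r msize0.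
have [->|q0] := eqVneq q 0; first by rewrite mulr0 msize0.
by move=> hp hq; rewrite msizeM //; lia.
Qed.

Lemma msize_exp_leS p d k : (msize p <= d.+1)%N -> (msize (p ^+ k) <= (k * d).+1)%N.
Proof.
move=> hp; elim: k => [|k IH]; first by rewrite expr0 msize1.
by rewrite exprS mulSn; apply: msizeM_leS.
Qed.

Lemma msize_prod_leS (I : finType) (F : I -> {mpoly R[n]}) d :
  (forall i, msize (F i) <= d.+1)%N -> (msize (\prod_i F i) <= (#|I| * d).+1)%N.
Proof.
move=> hF; rewrite cardE -big_enum; elim: (enum I) => [|i r IH].
  by rewrite big_nil msize1.
by rewrite big_cons mulSn; apply: msizeM_leS.
Qed.

Lemma card_bmultinom b : (#|{: 'X_{1..n < b}}| <= b ^ n)%N.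
Proof.
have hb (m : 'X_{1..n < b}) (i : 'I_n) : (m i < b)%N.
  by apply: leq_ltn_trans (bmdeg m); rewrite mdegE (bigD1 i) //= leq_addr.
pose F (m : 'X_{1..n < b}) := [ffun i => Ordinal (hb m i)].
have injF : injective F.
  move=> m m' /ffunP e; apply/val_inj/mnmP => i.
  by have := e i; rewrite !ffunE => /(congr1 val).
by have := leq_card _ injF; rewrite card_ffun !card_ord.
Qed.

(** A dimension count.  There are N^(n+1) products of the f_i and q with all
    exponents below N, whose degrees are below N * C for a constant C; they lie in
    a space of dimension at most (N * C)^n, which is smaller for N > C^n. *)
Lemma algebraic_dependence (f : 'I_n -> {mpoly R[n]}) (q : {mpoly R[n]}) :
  exists2 W : {poly {mpoly R[n]}}, W != 0 &
    (map_poly (mmap (@mpolyC n R) f) W).[q] = 0.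
Proof.
pose D := (msize q + \sum_i msize (f i))%N.
have hf i : (msize (f i) <= D.+1)%N.
  by rewrite /D (bigD1 i) //=; lia.
have hq : (msize q <= D.+1)%N by rewrite /D; lia.
pose C := (n * D + D + 1)%N.
pose N := (C ^ n).+1; pose b := (N * C)%N.
pose T := ({ffun 'I_n -> 'I_N} * 'I_N)%type.
pose mono (t : T) := \prod_i f i ^+ t.1 i * q ^+ t.2.
have hmono t : (msize (mono t) <= b)%N.
  have h1 : (msize (\prod_i f i ^+ t.1 i) <= (#|'I_n| * (N * D)).+1)%N.
    apply: msize_prod_leS => i; apply: leq_trans (msize_exp_leS _ (hf i)) _.
    by rewrite ltnS leq_mul2r ltnW ?orbT.
  have h2 : (msize (q ^+ t.2) <= (N * D).+1)%N.
    apply: leq_trans (msize_exp_leS _ hq) _.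
    by rewrite ltnS leq_mul2r ltnW ?orbT.
  apply: leq_trans (msizeM_leS h1 h2) _; rewrite card_ord /b /C.
  have N0 : (0 < N)%N by [].
  by nia.
pose S : finType := 'X_{1..n < b}.
pose M : 'M[{fraction R}]_(#|{: T}|, #|{: S}|) :=
  \matrix_(t, s) ((mono (enum_val t))@_(enum_val s : S))%:F.
have ltST : (#|{: S}| < #|{: T}|)%N.
  apply: leq_ltn_trans (card_bmultinom b) _.
  rewrite card_prod card_ffun !card_ord /b expnMn ltn_pmul2l ?expn_gt0 //.
have : kermx M != 0.
  rewrite kermx_eq0 /row_free; apply: contraL ltST => /eqP <-.
  by rewrite -leqNgt rank_leq_col.
move=> /rowV0Pn[v /sub_kermxP vM v0].
have [d d0 hd] := common_denominator [seq v 0 t | t <- enum 'I_(#|{: T}|)].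
have /choice[a ha] : forall t, exists a, v 0 t = a%:F / d%:F.
  by move=> t; apply: hd; apply: map_f; rewrite mem_enum.
have dF : d%:F != 0 by rewrite tofrac_eq0.
have rel : \sum_(t : T) a (enum_rank t) *: mono t = 0.
  apply/mpolyP => m; rewrite mcoeff0 raddf_sum /=.
  have [mb|mb] := ltnP (mdeg m) b; last first.
    rewrite big1 // => t _; rewrite mcoeffZ memN_msupp_eq0 ?mulr0 //.
    by apply: msize_mdeg_ge; apply: leq_trans mb.
  have := congr1 (fun A : 'M_(_, _) => A 0 (enum_rank (BMultinom mb : S))) vM.
  rewrite !mxE => e; apply/eqP; rewrite -(tofrac_eq0 (\sum_(_ | _) _)); apply/eqP.
  transitivity (d%:F * \sum_j v 0 j * M j (enum_rank (BMultinom mb : S))).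
    rewrite rmorph_sum mulr_sumr.
    rewrite (reindex (@enum_val T predT)) /=; last exact: onW_bij (@enum_val_bij T).
    apply: eq_bigr => t _; rewrite !mxE enum_valK enum_rankK mcoeffZ rmorphM ha.
    by rewrite mulrA mulrCA mulfV // mulr1.
  by rewrite e mulr0.
pose mm (u : {ffun 'I_n -> 'I_N}) : 'X_{1..n} := [multinom (u i : nat) | i < n].
have mm_inj : injective mm.
  move=> u u' /mnmP e; apply/ffunP => i; apply: val_inj.
  by have := e i; rewrite !mnmE.
exists (\sum_(t : T) (a (enum_rank t) *: 'X_[mm t.1]) *: 'X^(t.2)).
  have [t vt] : exists t, v 0 t != 0.
    apply: contrapT => h; case/eqP: v0; apply/rowP => t; rewrite mxE.
    by apply/eqP; apply: contraT => vt; case: h; exists t.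
  have at0 : a t != 0.
    by apply: contraNneq vt; rewrite ha => ->; rewrite rmorph0 mul0r.
  apply: contraNneq at0 => /polyP/(_ (enum_val t).2).
  rewrite coef0 coef_sum => /mpolyP/(_ (mm (enum_val t).1)).
  rewrite mcoeff0 raddf_sum /= (bigD1 (enum_val t)) //= big1 ?addr0.
    rewrite coefZ coefXn eqxx mulr1 mcoeffZ mcoeffX eqxx mulr1 enum_valK.
    by move=> ->.
  move=> s st; rewrite coefZ coefXn; case: eqP => e2; last by rewrite mulr0 mcoeff0.
  rewrite mulr1 mcoeffZ mcoeffX; case: eqP => e1; last by rewrite mulr0.
  case/eqP: st; rewrite [s]surjective_pairing [enum_val t]surjective_pairing.
  by rewrite (mm_inj _ _ e1) (val_inj e2).
rewrite rmorph_sum horner_sum -[RHS]rel; apply: eq_bigr => t _.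
rewrite -mul_polyC rmorphM /= map_polyC map_polyXn hornerM hornerC hornerXn /=.
rewrite mmapZ mmapX mul_mpolyC /mono scalerAl; congr (_ *: _ * _).
by apply: eq_bigr => i _; rewrite mnmE.
Qed.
End Dependence.

(** * The coordinates are rational functions of f *)

Lemma root_in_extension (F : fieldType) (P : {poly F}) : (1 < size P)%N ->
  exists (L : fieldType) (k : {rmorphism F -> L}) (z : L), root (map_poly k P) z.
Proof.
move=> sP; pose D m := `[< exists Q : {poly F}, [/\ (1 < size Q)%N, Q %| P & size Q = m] >].
have exD : exists m, D m by exists (size P); apply/asboolP; exists P.
case: (ex_minnP exD) => m /asboolP[Q [sQ QP eQ]] minm.
have irrQ : irreducible_poly Q.
  have Q0 : Q != 0 by rewrite -size_poly_gt0; lia.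
  split=> // T sT TQ; rewrite -dvdp_size_eqp // eqn_leq dvdp_leq //= eQ.
  apply/minm/asboolP; exists T; split=> //; last exact: dvdp_trans TQ QP.
  have : T != 0 by apply: contraNneq Q0 => T0; rewrite T0 dvd0p in TQ.
  rewrite -size_poly_gt0.
  by case: (size T) sT => [|[|]].
have [L _ [z rz _]] := irredp_FAdjoin irrQ.
exists L, (in_alg L), z; case/dvdpP: QP => T ->.
by rewrite rmorphM rootM rz orbT.
Qed.

(** The form in which surjectivity modulo the maximal ideals is used: only those
    with residue field F_p are needed to find the inverse up to a denominator. *)
Definition reductions_onto (R : comNzRingType) n (f : 'I_n -> {mpoly R[n]}) : Prop :=
  forall p (r : {rmorphism R -> 'F_p}), prime p ->
  forall b : 'I_n -> 'F_p, exists a, forall i, mmap r a (f i) = b i.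

Lemma surj_injective (T : finType) (h : T -> T) :
  (forall y, exists x, h x = y) -> injective h.
Proof.
move=> /choice[g hg]; have gK : cancel g h by [].
have [g' gg' g'g] := injF_bij (can_inj gK).
by move=> x y e; rewrite -[x]g'g -[y]g'g; congr g; rewrite -[g' x]gK -[g' y]gK !g'g e.
Qed.

(** Functions from 'I_n to F are compared pointwise, so the finite set behind the
    argument is that of the finite functions to F. *)
Lemma onto_injective_finite (F : choiceType) (s : seq F) n (h : ('I_n -> F) -> 'I_n -> F) :
  (forall x, x \in s) -> (forall a a', a =1 a' -> h a =1 h a') ->
  (forall y, exists x, h x =1 y) -> forall a a', h a =1 h a' -> a =1 a'.
Proof.
move=> hs ext surj a a' e.
pose T := {ffun 'I_n -> seq_sub s}.
pose into (u : 'I_n -> F) : T := [ffun i => SeqSub (hs (u i))].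
pose out (t : T) : 'I_n -> F := fun i => val (t i).
have intoK u : out (into u) =1 u by move=> i; rewrite /out ffunE.
have outK t : into (out t) = t by apply/ffunP => i; apply: val_inj; rewrite ffunE.
have := @surj_injective T (into \o h \o out) _ (into a) (into a').
have surjT y : exists x, (into \o h \o out) x = y.
  have [x hx] := surj (out y); exists (into x); rewrite -[RHS]outK; apply/ffunP => i.
  by apply: val_inj; rewrite !ffunE /= (ext _ _ (intoK x)).
move=> /(_ surjT) inj i; rewrite -(intoK a) -(intoK a').
rewrite inj //; apply/ffunP => k; apply: val_inj; rewrite !ffunE /=.
by rewrite (ext _ _ (intoK a)) (ext _ _ (intoK a')).
Qed.

(** A finite place defined on the variables and on 1 / P, in the field of
    rational functions. *)
Lemma nonvanishing_reduction (R : idomainType) n (P : {mpoly R[n]}) :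
  finitely_generated_ring R -> [pchar R] =i pred0 -> P != 0 ->
  exists p (r : {rmorphism R -> 'F_p}) (b : 'I_n -> 'F_p), prime p /\ mmap r b P != 0.
Proof.
move=> hR c0 P0.
pose j : {rmorphism R -> {fraction {mpoly R[n]}}} := @FracField.tofrac _ \o @mpolyC n R.
have injj : injective j.
  by move=> x y /eqP; rewrite /= tofrac_eq => /eqP/(can_inj (@mpolyCK n R)).
have [p [r [G [pp hG Gj Gg]]]] := finite_place_over
  ((P%:F)^-1 :: [seq ('X_i)%:F | i : 'I_n]) hR c0 injj.
have /choice[b hb] : forall i, exists y, G ('X_i)%:F y.
  move=> i; apply: Gg; rewrite inE; apply/orP; right; apply/mapP.
  by exists i; rewrite ?mem_enum.
have GP : G P%:F (mmap r b P).
  rewrite -{1}(mmap_mpolyX P) rmorph_mmap.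
  exact: (@ph_mmap _ _ _ hG _ _ j).
exists p, r, b; split=> //.
apply: (ph_neq0 hG (z := (P%:F)^-1)) GP _; first by rewrite divff // tofrac_eq0.
by apply: Gg; rewrite inE eqxx.
Qed.

Section RationalInverse.
Variables (R : idomainType) (n : nat) (f : 'I_n -> {mpoly R[n]}).
Hypotheses (hR : finitely_generated_ring R) (c0 : [pchar R] =i pred0)
  (onto : reductions_onto f).

Lemma reductions_injective p (r : {rmorphism R -> 'F_p}) (a a' : 'I_n -> 'F_p) :
  prime p -> (forall i, mmap r a (f i) = mmap r a' (f i)) -> a =1 a'.
Proof.
move=> pp e; apply: (onto_injective_finite (s := enum 'F_p) (h := fun a i => mmap r a (f i))) e.
- by move=> x; rewrite mem_enum.
- by move=> u v uv i; apply: eq_mmap.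
by move=> b; have [u hu] := onto r pp b; exists u.
Qed.

Definition subst_map : {rmorphism {mpoly R[n]} -> {mpoly R[n]}} :=
  mmap (@mpolyC n R) f.

(** Algebraic independence of f: if P(f) = 0, then P vanishes on the image of f in
    every F_p^n, which is everything. *)
Lemma subst_map_injective : injective subst_map.
Proof.
apply: raddf_inj => P e; apply/eqP; apply: contraT => P0.
have [p [r [b [pp]]]] := nonvanishing_reduction hR c0 P0.
have [a ha] := onto r pp b.
rewrite (@eq_mmap _ _ _ r r _ (fun i => mmap r a (f i))) //.
by rewrite -(mmap_mmap r id a f) -/(subst_map P) e raddf0 eqxx.
Qed.

(** With z a generator of K(x) over K(f), it suffices that z lies in K(f), that
    is, that its minimal polynomial N has degree 1.  Otherwise N has a second root
    z' in some extension, and sending z to z' over K(f) moves the point x to a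
    point x' with the same image under f. *)
Lemma rational_inverse i :
  exists A B : {mpoly R[n]}, B != 0 /\ subst_map A = 'X_i * subst_map B.
Proof.
pose j : {rmorphism {mpoly R[n]} -> {fraction {mpoly R[n]}}} :=
  @FracField.tofrac _ \o subst_map.
have injj : injective j.
  by move=> x y /eqP; rewrite /= tofrac_eq => /eqP/subst_map_injective.
have [iota iotaE] := frac_lift_exists injj.
pose jM : {rmorphism R -> {fraction {mpoly R[n]}}} := @FracField.tofrac _ \o @mpolyC n R.
have injjM : injective jM.
  by move=> x y /eqP; rewrite /= tofrac_eq => /eqP/(can_inj (@mpolyCK n R)).
have c0M : [pchar {fraction {mpoly R[n]}}] =i pred0.
  apply/pcharf0P => m; move/pcharf0P: c0 => <-.
  by rewrite -(rmorph_nat jM) -(rmorph0 jM) (inj_eq injjM).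
have alg x : x \in [seq ('X_i)%:F | i : 'I_n] -> algebraicOver iota x.
  move=> /mapP[k _ ->]; have [W W0 Wk] := algebraic_dependence f 'X_k.
  exists (map_poly (@FracField.tofrac _) W).
    apply: contraNneq W0 => /polyP W0; apply/eqP/polyP => m; have := W0 m.
    by rewrite coef_map !coef0 => /eqP; rewrite tofrac_eq0 => /eqP.
  rewrite -map_poly_comp (eq_map_poly (g := @FracField.tofrac _ \o subst_map)) //.
  by rewrite map_poly_comp rootE horner_map Wk rmorph0.
have [z az hz] := primitive_element c0M alg.
have /choice[q hq] : forall k, exists q, ('X_k)%:F = (map_poly iota q).[z].
  by move=> k; apply: hz; apply/mapP; exists k; rewrite ?mem_enum.
have [N [mN rN minN]] := minimal_polynomial az.
have [sN|sN] := leqP (size N) 2.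
  have [c zc] : exists c, z = iota c.
    have s2 : size N = 2.
      apply/eqP; rewrite eqn_leq sN ltnNge; apply/negP => /size1_polyC eN.
      move: mN rN; rewrite eN monicE lead_coefC => /eqP ->.
      by rewrite rmorph1 rootE hornerC oner_eq0.
    exists (- N`_0); move: rN; rewrite rootE horner_coef size_map_poly s2.
    rewrite !big_ord_recl big_ord0 /= !coef_map /= expr0 mulr1 addr0 expr1.
    have -> : N`_(bump 0 0) = 1 by have := monicP mN; rewrite lead_coefE s2.
    by rewrite rmorph1 mul1r addrC addr_eq0 rmorphN => /eqP.
  have [A [B [B0 eAB]]] := fracE (q i).[c].
  exists A, B; split; first exact: B0.
  have eX : ('X_i)%:F = iota (A%:F / B%:F) by rewrite (hq i) zc horner_map eAB.
  apply/eqP; rewrite -tofrac_eq tofracM eX fmorph_div.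
  have iE P : iota P%:F = (subst_map P)%:F by exact: iotaE.
  have sB : (subst_map B)%:F != 0.
    by rewrite -iE fmorph_eq0 tofrac_eq0.
  by rewrite (iE A) (iE B) (divfK sB) eqxx.
exfalso.
have /factor_theorem[N1 eN] := rN.
have sN1 : (1 < size N1)%N.
  have N10 : N1 != 0.
    apply: contraTneq (monic_neq0 mN) => e; move: eN; rewrite e mul0r => /eqP.
    by rewrite map_poly_eq0 => ->.
  have := size_map_poly iota N; rewrite eN size_Mmonic ?monicXsubC //.
  by rewrite size_XsubC addn2 /= => e; rewrite -ltnS e.
have [L [k [z' rz']]] := root_in_extension sN1.
(* N is separable: its derivative is nonzero of smaller degree. *)
have zz' : k z != z'.
  apply/eqP => e; have N1z : root N1 z.
    by move: rz'; rewrite -e rootE horner_map fmorph_eq0.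
  have : N %| N^`().
    apply: minN; rewrite -deriv_map eN derivM derivXsubC mulr1 rootE hornerD hornerM.
    by rewrite hornerXsubC subrr mulr0 add0r.
  have N'0 : N^`() != 0.
    apply/eqP => /polyP/(_ (size N).-2); rewrite coef_deriv coef0.
    have -> : (size N).-2.+1 = (size N).-1 by lia.
    move/eqP; rewrite -lead_coefE (monicP mN).
    move/pcharf0P: c0M => ->; lia.
  have := lt_size_deriv (monic_neq0 mN); rewrite ltnNge => /negP h /(dvdp_leq N'0).
  exact: h.
pose ki : {rmorphism {fraction {mpoly R[n]}} -> L} := k \o iota.
(* G is the K(f)-homomorphism that sends z to z'. *)
have hki := graph_partial_hom ki.
have rz2 : root (map_poly ki N) z'.
  by rewrite map_poly_comp eN rmorphM rootM rz'.
have hrel (P : {poly {fraction {mpoly R[n]}}}) :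
    poly_rel (fun x y => y = ki x) P (map_poly ki P).
  by move=> m; rewrite coef_map.
have hG := algebraic_partial_hom hki mN minN (hrel N) rz2.
set G := (G in partial_hom G) in hG.
have Gq P : G (map_poly iota P).[z] (map_poly ki P).[z'] by exists P, (map_poly ki P).
have Giota e : G (iota e) (k (iota e)).
  by have := Gq e%:P; rewrite !map_polyC !hornerC.
pose x' m := (map_poly ki (q m)).[z'].
pose kj : {rmorphism R -> L} := k \o jM.
have GX m : G ('X_m)%:F (x' m) by rewrite hq; exact: Gq.
have Gc c : G (jM c) (kj c).
  by have := Giota (c%:MP)%:F; rewrite iotaE /j /= /subst_map /= mmapC.
have GP P : G P%:F (mmap kj x' P).
  rewrite -{1}(mmap_mpolyX P) rmorph_mmap.
  exact: (@ph_mmap _ _ _ hG _ _ jM).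
have kP P : k P%:F = mmap kj (fun m => k ('X_m)%:F) P.
  by rewrite -{1}(mmap_mpolyX P) !rmorph_mmap.
have fx' m : mmap kj x' (f m) = k (f m)%:F.
  apply: (ph_fun hG (GP _)); have := Giota ('X_m)%:F.
  by rewrite iotaE /j /= /subst_map /= mmap1Ui.
(* z is a rational function of x, so x' = x would give z' = z. *)
have [m0 hm0] : exists m, x' m != k ('X_m)%:F.
  apply: contrapT => h; case/eqP: zz'.
  have ex m : x' m = k ('X_m)%:F by apply/eqP; apply: contraT => hm; case: h; exists m.
  have [U [V [V0 eUV]]] := fracE z.
  have kx P : mmap kj x' P = k P%:F by rewrite kP; apply: eq_mmap.
  have VF : V%:F != 0 by rewrite tofrac_eq0.
  have Gz : G z z'.
    by have := Gq 'X; rewrite !map_polyX !hornerX.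
  have := phM hG Gz (GP V); rewrite {1}eUV divfK // => /(ph_fun hG (GP U)).
  rewrite !kx => e; apply: (mulIf (_ : k V%:F != 0)); first by rewrite fmorph_eq0.
  by rewrite -e -rmorphM eUV divfK.
have [|p [r [H [pp hH Hj Hg]]]] := finite_place_over
  ((x' m0 - k ('X_m0)%:F)^-1 :: [seq x' m | m : 'I_n] ++ [seq k ('X_m)%:F | m : 'I_n])
  hR c0 (j := kj).
  by move=> x y /fmorph_inj/injjM.
have /choice[a ha] : forall m, exists y, H (k ('X_m)%:F) y.
  move=> m; apply: Hg; rewrite inE mem_cat; apply/or3P/Or33; apply/mapP.
  by exists m; rewrite ?mem_enum.
have /choice[a' ha'] : forall m, exists y, H (x' m) y.
  move=> m; apply: Hg; rewrite inE mem_cat; apply/or3P/Or32; apply/mapP.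
  by exists m; rewrite ?mem_enum.
have /(_ m0) : a' =1 a.
  apply: (reductions_injective pp (r := r)) => m.
  have h1 := ph_mmap hH (f m) Hj ha'; have h2 := ph_mmap hH (f m) Hj ha.
  by apply: (ph_fun hH h1); rewrite fx' kP.
move/eqP; rewrite -subr_eq0; apply/negP.
apply: (ph_neq0 hH (z := (x' m0 - k ('X_m0)%:F)^-1)) (phB hH (ha' m0) (ha m0)) _.
  by rewrite divff // subr_eq0.
by apply: Hg; rewrite inE eqxx.
Qed.
End RationalInverse.

(** * The coordinates are polynomials in f, up to a denominator *)

(** P' / Q' is the fraction P / Q in lowest terms over the fraction field of A,
    and the last equation is a Bezout relation cleared of denominators. *)
Lemma reduced_pair (A : idomainType) (P Q : {poly A}) : Q != 0 ->
  exists P' Q' U V c, [/\ c != 0, Q' != 0, P' * Q = P * Q' & U * P' + V * Q' = c%:P].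
Proof.
move=> Q0; have g0 : gcdp P Q != 0 by rewrite gcdp_eq0 negb_and Q0 orbT.
have e1 := Pdiv.Idomain.divpK (dvdp_gcdl P Q).
have e2 := Pdiv.Idomain.divpK (dvdp_gcdr P Q).
have : coprimep (P %/ gcdp P Q) (Q %/ gcdp P Q).
  by apply: coprimep_div_gcd; rewrite Q0 orbT.
set P1 := P %/ _ in e1 *; set Q1 := Q %/ _ in e2 *; set g := gcdp P Q in g0 e1 e2 *.
set k1 := (_ ^+ _) in e1; set k2 := (_ ^+ _) in e2.
have k10 : k1 != 0 by rewrite expf_neq0 // lead_coef_eq0.
have k20 : k2 != 0 by rewrite expf_neq0 // lead_coef_eq0.
move=> /Bezout_coprimepP[[U V] /= /eqp_size]; rewrite size_poly1 => /eqP/size_poly1P[c c0 eUV].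
exists (k2 *: P1), (k1 *: Q1), (k1 *: U), (k2 *: V), (k1 * k2 * c); split.
- by rewrite !mulf_neq0.
- rewrite -mul_polyC mulf_neq0 ?polyC_eq0 //; apply: contraNneq Q0 => q0.
  by move: e2; rewrite q0 mul0r -mul_polyC => /esym/eqP; rewrite mulf_eq0 polyC_eq0 (negPf k20).
- by rewrite -scalerAl scalerAr -e2 -scalerAr scalerAl -e1; ring.
rewrite -!scalerAl -!scalerAr !scalerA [k2 * k1]mulrC -scalerDr eUV.
by rewrite -mul_polyC -polyCM.
Qed.

Lemma mulr_perm (T : comNzRingType) (w x y z : T) : w * (z * y) * x = z * x * (w * y).
Proof. by ring. Qed.

Section Homogenize.
Variables (R : comNzRingType) (n : nat).
Implicit Types P : {mpoly R[n]}.

(** Homogenisation of P to degree d by a new variable u: at u = 1 it gives back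
    P, and its values compute P at the point v / u of the line through v. *)
Definition homogenize d P : {poly {mpoly R[n]}} :=
  \sum_(m <- msupp P) (P@_m *: 'X_[m]) *: 'X^(d - mdeg m).

Definition eval_at (T : comNzRingType) (r : {rmorphism R -> T}) (v : 'I_n -> T) (u : T)
  : {rmorphism {poly {mpoly R[n]}} -> T} :=
  horner_eval u \o map_poly (mmap r v).

Lemma eval_atC (T : comNzRingType) (r : {rmorphism R -> T}) v u P :
  eval_at r v u P%:P = mmap r v P.
Proof. by rewrite /eval_at /= map_polyC /horner_eval hornerC. Qed.

Lemma eval_atX (T : comNzRingType) (r : {rmorphism R -> T}) v u :
  eval_at r v u 'X = u.
Proof. by rewrite /eval_at /= map_polyX /horner_eval hornerX. Qed.

Lemma ph_eval_at (S T : comNzRingType) (G : S -> T -> Prop) (j : {rmorphism R -> S})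
    (r : {rmorphism R -> T}) (v : 'I_n -> S) (w : 'I_n -> T) u t (P : {poly {mpoly R[n]}}) :
  partial_hom G -> (forall c, G (j c) (r c)) -> (forall i, G (v i) (w i)) -> G u t ->
  G (eval_at j v u P) (eval_at r w t P).
Proof.
move=> hG Gc Gv Gu; apply: (ph_horner hG) => // i.
by rewrite !coef_map; apply: ph_mmap.
Qed.

Lemma eval_homogenize (T : comNzRingType) (r : {rmorphism R -> T}) (v : 'I_n -> T) u d P :
  (msize P <= d.+1)%N ->
  eval_at r (fun i => u * v i) u (homogenize d P) = u ^+ d * mmap r v P.
Proof.
move=> hd; rewrite /homogenize rmorph_sum /mmap mulr_sumr big_seq [RHS]big_seq.
apply: eq_bigr => m mP; have md : (mdeg m <= d)%N.
  by rewrite -ltnS; apply: leq_trans (msize_mdeg_lt mP) hd.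
rewrite /eval_at /= -mul_polyC rmorphM /= map_polyC map_polyXn /horner_eval.
rewrite hornerM hornerC hornerXn /= mmapZ mmapX.
by rewrite mmap1_scale -{2}(subnKC md) exprD; ring.
Qed.

Lemma eval_homogenize1 d P : (homogenize d P).[1] = P.
Proof.
rewrite /homogenize horner_sum [RHS]mpolyE; apply: eq_bigr => m _.
by rewrite hornerZ hornerXn expr1n mulr1.
Qed.

(** The leading coefficient in u is a constant: this is the reason for putting
    the centre of the lines where P does not vanish. *)
Lemma lead_coef_homogenize d P : (msize P <= d.+1)%N -> P@_0%MM != 0 ->
  lead_coef (homogenize d P) = (P@_0%MM)%:MP.
Proof.
move=> hd P0; have P0s : 0%MM \in msupp P by rewrite mcoeff_msupp.
have cd : (homogenize d P)`_d = (P@_0%MM)%:MP.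
  rewrite /homogenize coef_sum (bigD1_seq 0%MM) ?msupp_uniq //= big1_seq => [|m /andP[m0 mP]].
    by rewrite coefZ coefXn mdeg0 subn0 eqxx mulr1 addr0 mpolyX0 alg_mpolyC.
  rewrite coefZ coefXn; case: eqP => [e|]; last by rewrite mulr0.
  case/eqP: m0; apply/eqP; rewrite -mdeg_eq0.
  by have := leq_trans (msize_mdeg_lt mP) hd; lia.
rewrite lead_coefE; suff -> : size (homogenize d P) = d.+1 by [].
apply/eqP; rewrite eqn_leq; apply/andP; split.
  apply: (leq_trans (size_sum _ _ _)); apply/bigmax_leqP_seq => m _ _.
  by apply: leq_trans (size_scale_leq _ _) _; rewrite size_polyXn ltnS leq_subr.
rewrite ltnNge; apply/negP => h; move: cd; rewrite nth_default // => /esym/eqP.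
by rewrite mpolyC_eq0 (negPf P0).
Qed.
End Homogenize.

Section PolynomialInverse.
Variables (R : idomainType) (n : nat).
Hypotheses (hR : finitely_generated_ring R) (c0 : [pchar R] =i pred0).

Lemma nonroot_exists (P : {mpoly R[n]}) : P != 0 -> exists b : 'I_n -> R, P.@[b] != 0.
Proof.
move=> /(nonvanishing_reduction hR c0)[p [r [b [_ nz]]]].
exists (fun i => (b i : nat)%:R); move: nz.
apply: contraNneq => /(congr1 r); rewrite rmorph0 /meval rmorph_mmap => e.
apply/eqP; rewrite -[RHS]e; apply: eq_mmap => // i /=.
by rewrite rmorph_nat natr_Zp.
Qed.

(** On the line of points v / u, the rational function A / B becomes A' / B' in
    lowest terms, with A', B' polynomials in u over R[v].  The substitution
    v := u f(x) turns x_i B(f) = A(f) into A' = x_i B'.  Hence B' has no nonzero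
    root u = w in any extension of the field of rational functions in v: a
    finite place defined on w, 1 / w and 1 / A'(w), together with a preimage
    under f of v / w, would give A'(w) = 0.  So B' is a constant times a power of
    u, the homogenisation of B divides that of A times this power of u over the
    fraction field, and since its leading coefficient is the constant B(0), a
    pseudo-division gives a quotient with coefficients in R[v] after
    multiplication by a power of B(0). *)
Lemma centered_polynomial_inverse (f : 'I_n -> {mpoly R[n]}) i (A B : {mpoly R[n]}) :
  reductions_onto f -> B@_0%MM != 0 -> subst_map f A = 'X_i * subst_map f B ->
  exists C s, s != 0 /\ subst_map f C = s *: 'X_i.
Proof.
move=> onto B0 eAB; pose d := (msize A + msize B)%N.
have dA : (msize A <= d.+1)%N by rewrite /d; lia.
have dB : (msize B <= d.+1)%N by rewrite /d; lia.
pose Ah := homogenize d A; pose Bh := homogenize d B.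
have lB : lead_coef Bh = (B@_0%MM)%:MP by apply: lead_coef_homogenize.
have Bh0 : Bh != 0 by rewrite -lead_coef_eq0 lB mpolyC_eq0.
have Bn0 : subst_map f B != 0.
  rewrite -(raddf0 (subst_map f)) (inj_eq (subst_map_injective hR c0 onto)).
  by apply: contraNneq B0 => ->; rewrite mcoeff0.
have [A' [B' [U [V [c [cn0 B'0 eAB' bez]]]]]] := reduced_pair Ah Bh0.
(* The substitution v := u f(x). *)
pose sg := eval_at (polyC \o @mpolyC n R : {rmorphism R -> {poly {mpoly R[n]}}})
   (fun k => 'X * (f k)%:P) 'X.
have sgE P : (msize P <= d.+1)%N -> sg (homogenize d P) = 'X^d * (subst_map f P)%:P.
  by move=> hP; rewrite /sg eval_homogenize // rmorph_mmap.
have sgA : sg A' = ('X_i)%:P * sg B'.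
  have := congr1 sg eAB'; rewrite !rmorphM !sgE // eAB rmorphM => e.
  have X0 : 'X^d * (subst_map f B)%:P != 0 :> {poly {mpoly R[n]}}.
    by rewrite mulf_neq0 ?polyC_eq0 // expf_neq0 // polyX_eq0.
  by apply: (mulIf X0); rewrite e; apply: mulr_perm.
(* A root t of B' over F_p is a root of A': evaluate A' = x_i B' at a preimage of b / t. *)
have pt p (r : {rmorphism R -> 'F_p}) (b : 'I_n -> 'F_p) t : prime p -> t != 0 ->
    eval_at r b t B' = 0 -> eval_at r b t A' = 0.
  move=> pp t0 hB; have [a ha] := onto p r pp (fun k => b k / t).
  have key P : eval_at r a t (sg P) = eval_at r b t P.
    pose w := mmap (polyC \o @mpolyC n R) (fun k => 'X * (f k)%:P).
    have -> : sg P = (map_poly w P).['X] by [].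
    rewrite -(horner_map (eval_at r a t)) eval_atX -map_poly_comp.
    congr (horner _ _); apply: eq_map_poly => q.
    transitivity (eval_at r a t (w q)); first by [].
    rewrite (rmorph_mmap (eval_at r a t)); apply: eq_mmap => [z|k].
      transitivity (eval_at r a t (z%:MP)%:P); first by [].
      by rewrite eval_atC mmapC.
    transitivity (eval_at r a t ('X * (f k)%:P)); first by [].
    by rewrite rmorphM eval_atX eval_atC ha mulrC divfK.
  by rewrite -key sgA rmorphM key hB mulr0.
have [e [B2 B20 eB]] := multiplicity_XsubC B' 0.
rewrite B'0 /= in B20.
have sB2 : (size B2 <= 1)%N.
  rewrite leqNgt; apply/negP => sB2.
  have injF : injective (@FracField.tofrac {mpoly R[n]}).
    by move=> x y /eqP; rewrite tofrac_eq => /eqP.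
  have sB2F : (1 < size (map_poly (@FracField.tofrac {mpoly R[n]}) B2))%N.
    by rewrite (size_map_inj_poly injF) ?rmorph0.
  have [L [k [u ru]]] := root_in_extension sB2F.
  pose kt : {rmorphism {mpoly R[n]} -> L} := k \o @FracField.tofrac _.
  have injkt : injective kt by move=> x y /fmorph_inj/injF.
  pose j : {rmorphism R -> L} := kt \o @mpolyC n R.
  have injj : injective j by move=> x y /injkt/(can_inj (@mpolyCK n R)).
  pose ev := eval_at j (fun m => kt 'X_m) u.
  have evE P : ev P = (map_poly kt P).[u].
    rewrite /ev /eval_at /=; congr (horner _ _); apply: eq_map_poly => q.
    by rewrite -{2}(mmap_mpolyX q) rmorph_mmap.
  have evB2 : ev B2 = 0.
    by rewrite evE /kt map_poly_comp; apply/eqP.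
  have evB' : ev B' = 0 by rewrite eB rmorphM evB2 mul0r.
  have u0 : u != 0.
    apply: contraNneq B20 => e0; move: evB2; rewrite evE e0 -(rmorph0 kt) horner_map.
    by move/injkt/eqP.
  have evA' : ev A' != 0.
    apply: contraNneq cn0 => evA'; have := congr1 ev bez.
    rewrite rmorphD !rmorphM evA' evB' !mulr0 addr0 evE map_polyC hornerC.
    by rewrite -(rmorph0 kt) => /injkt ->.
  have [p [r [G [pp hG Gj Gg]]]] := finite_place_over
    ((ev A')^-1 :: u :: u^-1 :: [seq kt 'X_m | m : 'I_n]) hR c0 injj.
  have /choice[b hb] : forall m, exists y, G (kt 'X_m) y.
    move=> m; apply: Gg; rewrite !inE; apply/or4P/Or44/mapP.
    by exists m; rewrite ?mem_enum.
  have [t hu] : exists t, G u t by apply: Gg; rewrite !inE eqxx orbT.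
  have Gev P : G (ev P) (eval_at r b t P) by apply: ph_eval_at.
  have t0 : t != 0.
    apply: (ph_neq0 hG (z := u^-1)) hu _; first by rewrite divff.
    by apply: Gg; rewrite !inE eqxx !orbT.
  have := Gev B'; rewrite evB' => /(ph0 hG) /(pt _ _ _ _ pp t0); apply/eqP.
  apply: (ph_neq0 hG (z := (ev A')^-1)) (Gev A') _; first by rewrite divff.
  by apply: Gg; rewrite !inE eqxx.
have [b eb] : exists b, B2 = b%:P by exists B2`_0; apply: size1_polyC.
have b0 : b != 0.
  by apply: contraNneq B20 => e0; rewrite eb e0 polyC0 root0.
have : Bh %| Ah * 'X^e.
  apply/Pdiv.Idomain.dvdpP; exists (b, A') => //=.
  by rewrite eAB' eB eb subr0 -mul_polyC mulrCA mulrA mulrC.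
move=> /Pdiv.Idomain.divpK; set S := _ %/ _; set k := scalp _ _; rewrite lB => eS.
exists S.[1], (B@_0%MM ^+ k); split; first by rewrite expf_neq0.
have eC : S.[1] * B = (B@_0%MM ^+ k) *: A.
  have := congr1 (fun P => P.[1]) eS.
  rewrite hornerM hornerZ hornerM hornerXn expr1n mulr1 !eval_homogenize1 => ->.
  by rewrite -mul_mpolyC rmorphXn.
apply: (mulIf Bn0); rewrite -rmorphM eC -mul_mpolyC rmorphM eAB.
have -> : subst_map f (B@_0%MM ^+ k)%:MP = (B@_0%MM ^+ k)%:MP.
  by rewrite /subst_map /= mmapC.
by rewrite mulrA mul_mpolyC.
Qed.

(** The origin is translated to a point b with B(b) nonzero. *)
Theorem polynomial_inverse (f : 'I_n -> {mpoly R[n]}) i : reductions_onto f ->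
  exists C s, s != 0 /\ subst_map f C = s *: 'X_i.
Proof.
move=> onto; have [A [B [B0 eAB]]] := rational_inverse hR c0 onto i.
have [b Bb] := nonroot_exists B0.
pose f' k := f k - (b k)%:MP.
have onto' : reductions_onto f'.
  move=> p r pp y; have [a ha] := onto p r pp (fun k => y k + r (b k)).
  by exists a => k; rewrite rmorphB /= mmapC ha addrK.
have sh (g : 'I_n -> {mpoly R[n]}) (e : 'I_n -> R) P :
    subst_map g (subst_map (fun k => 'X_k + (e k)%:MP) P) =
    subst_map (fun k => g k + (e k)%:MP) P.
  rewrite [LHS]rmorph_mmap; apply: eq_mmap => [z|k]; first exact: mmapC.
  by rewrite /= mmapD mmap1Ui mmapC.
pose t := subst_map (fun k => 'X_k + (b k)%:MP).
have shf P : subst_map f' (t P) = subst_map f P.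
  by rewrite sh; apply: eq_mmap => // k; rewrite subrK.
have tB0 : (t B)@_0%MM != 0.
  suff -> : (t B)@_0%MM = B.@[b] by [].
  rewrite /t [LHS](rmorph_mmap (mcoeff 0%MM)); apply: eq_mmap => [z|k] /=.
    exact: mpolyCK.
  rewrite mcoeffD mpolyCK mcoeffX; case: eqP => [|_]; last by rewrite add0r.
  by move=> /mnmP/(_ k); rewrite mnm1E mnm0E eqxx.
have [|C [s [s0 eC]]] := centered_polynomial_inverse (A := t A) (i := i) onto' tB0.
  exact: etrans (shf A) (etrans eAB (congr1 ( *%R 'X_i) (esym (shf B)))).
exists (subst_map (fun k => 'X_k + (- b k)%:MP) C), s; split; first exact: s0.
rewrite sh -eC; apply: eq_mmap => // k; by rewrite mpolyCN.
Qed.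
End PolynomialInverse.

(** * Maximal ideals and residue fields *)

Section MaximalIdeals.
Variables (R : comNzRingType) (m : max_ideal R).

Lemma max_ideal0 : 0 \in (m : {pred R}).
Proof. by case: (max_idealP m) => [[]]. Qed.

Lemma max_ideal1 : 1 \notin (m : {pred R}).
Proof. by case: (max_idealP m) => [[]]. Qed.

Lemma max_idealMD a x y : x \in (m : {pred R}) -> y \in (m : {pred R}) -> a * x + y \in (m : {pred R}).
Proof. by case: (max_idealP m) => [[_ _ h] _]; apply: h. Qed.

Lemma max_idealD x y : x \in (m : {pred R}) -> y \in (m : {pred R}) -> x + y \in (m : {pred R}).
Proof. by move=> hx hy; rewrite -[x]mul1r max_idealMD. Qed.

Lemma max_idealM a x : x \in (m : {pred R}) -> a * x \in (m : {pred R}).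
Proof. by move=> hx; rewrite -[_ * _]addr0 max_idealMD // max_ideal0. Qed.

Lemma max_ideal_sum (I : Type) (r : seq I) (P : pred I) (F : I -> R) :
  (forall i, P i -> F i \in (m : {pred R})) -> \sum_(i <- r | P i) F i \in (m : {pred R}).
Proof. by move=> h; elim/big_ind: _ => //; [exact: max_ideal0 | exact: max_idealD]. Qed.

(** Otherwise m and x would generate a larger proper ideal. *)
Lemma max_ideal_inv x : x \notin (m : {pred R}) -> exists y, 1 - x * y \in (m : {pred R}).
Proof.
move=> xm; case: (max_idealP m) => _ maxm; apply: contrapT => h.
pose J : {pred R} := fun z => `[< exists a y, a \in (m : {pred R}) /\ z = a + x * y >].
have JI : idealr_closed J.
  split.
  - by apply/asboolP; exists 0, 0; rewrite max_ideal0 mulr0 addr0.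
  - apply/negP => /asboolP[a [y [am e]]]; apply: h; exists y.
    by rewrite e addrK.
  move=> c _ _ /asboolP[a [y [am ->]]] /asboolP[b [z [bm ->]]].
  by apply/asboolP; exists (c * a + b), (c * y + z); rewrite max_idealMD //; split=> //; ring.
have sub : {subset (m : {pred R}) <= J}.
  by move=> a am; apply/asboolP; exists a, 0; rewrite mulr0 addr0.
have := maxm J JI sub x; rewrite (negPf xm) => /negbT/negP; apply.
by apply/asboolP; exists 0, 1; rewrite max_ideal0 mulr1 add0r.
Qed.

Lemma mem_adic0 x : (x \in adic_ideal m 0) = (x \in (m : {pred R})).
Proof.
apply/idP/idP => [/asboolP[s [hs ->]]|xm].
  rewrite big_seq; apply: max_ideal_sum => u /hs[um _].
  by rewrite mulrC max_idealM.
by apply/asboolP; exists [:: (x, 1)]; rewrite big_seq1 mulr1; split=> // u; rewrite inE => /eqP ->.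
Qed.

Lemma mem_adic1_mul x y : x \in (m : {pred R}) -> y \in (m : {pred R}) -> x * y \in adic_ideal m 1.
Proof.
move=> xm ym; apply/asboolP; exists [:: (x, y)]; rewrite big_seq1; split=> // u.
by rewrite inE => /eqP ->; split=> //; rewrite -[_ \in _]mem_adic0 in ym.
Qed.

Lemma mem_adic1 x : x \in adic_ideal m 1 -> exists s : seq (R * R),
  (forall u, u \in s -> u.1 \in (m : {pred R}) /\ u.2 \in (m : {pred R})) /\
  x = \sum_(u <- s) u.1 * u.2.
Proof.
move=> /asboolP[s [hs e]]; exists s; split=> // u /hs[u1 u2]; split=> //.
by rewrite -mem_adic0.
Qed.

Lemma residue_field : finite_set [set: residue_ring m] ->
  exists (F : fieldType) (h : {rmorphism R -> F}) (s : seq F),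
    [/\ forall r, (h r == 0) = (r \in (m : {pred R})),
        forall y, exists r, h r = y & forall y, y \in s].
Proof.
move=> fin; pose Q := {ideal_quot (max_ideal_pred m)}.
pose h : {rmorphism R -> Q} := \pi_Q%qT.
have hE r : (h r == 0) = (r \in (m : {pred R})).
  by rewrite -(rmorph0 h) -Quotient.idealrBE subr0.
have hsurj (y : Q) : exists r, h r = y by exists (repr y); exact: reprK.
have /choice[inv hinv] : forall y : Q, exists z : Q, (y != 0 -> z * y = 1) /\ (y = 0 -> z = 0).
  move=> y; have [-> |y0] := eqVneq y 0; first by exists 0; split.
  have [r hr] := hsurj y; have [|t ht] := @max_ideal_inv r.
    by rewrite -hE hr.
  exists (h t); split=> [_|e]; last by rewrite e eqxx in y0.
  move: ht; rewrite -hE rmorphB rmorph1 rmorphM hr subr_eq0.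
  by rewrite mulrC => /eqP.
have i1 : forall x : Q, x != 0 -> inv x * x = 1 by move=> x; case: (hinv x).
have i0 : inv 0 = 0 by case: (hinv 0) => _; apply.
pose FF := GRing.ComNzRing_isField.Build Q i1 i0.
pose F : fieldType := HB.pack Q FF.
have fin' : finite_set [set: Q] by [].
move/finite_seqP: fin' => [s hs].
exists F, h, (s : seq Q); split=> // y.
have : [set: Q]%classic y by [].
by rewrite hs.
Qed.

End MaximalIdeals.

(** Zorn's lemma, applied to the proper ideals that contain d. *)
Lemma exists_max_ideal (R : comNzRingType) (d : R) : (forall y, d * y != 1) ->
  exists m : max_ideal R, d \in (m : {pred R}).
Proof.
move=> nud; pose isI (J : R -> bool) := idealr_closed (J : {pred R}) /\ J d.
pose T := {J : R -> bool | isI J}.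
pose le (J J' : T) := `[< forall x, sval J x -> sval J' x >].
pose I0 z := `[< exists y, z = d * y >].
have I0P : isI I0.
  split; last by apply/asboolP; exists 1; rewrite mulr1.
  split.
  - by apply/asboolP; exists 0; rewrite mulr0.
  - by apply/negP => /asboolP[y /esym/eqP]; apply/negP.
  move=> a _ _ /asboolP[y ->] /asboolP[z ->]; apply/asboolP.
  by exists (a * y + z); rewrite mulrDr mulrCA.
have leT (A : set T) : total_on A le -> exists t, forall J, A J -> le J t.
  move=> tot; have [[J0 AJ0]|A0] := pselect (exists J, A J); last first.
    by exists (exist _ I0 I0P) => J AJ; case: A0; exists J.
  pose U z := `[< exists2 J, A J & sval J z >].
  have UP : isI U.
    split; last by apply/asboolP; exists J0 => //; case: (svalP J0).
    split.
    - by apply/asboolP; exists J0 => //; case: (svalP J0) => [[]].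
    - by apply/negP => /asboolP[J _]; apply/negP; case: (svalP J) => [[]].
    move=> a x y /asboolP[J AJ xJ] /asboolP[K AK yK]; apply/asboolP.
    have [/asboolP JK|/asboolP KJ] := tot _ _ AJ AK.
      by exists K => //; case: (svalP K) => [[_ _ h] _]; apply: h => //; apply: JK.
    by exists J => //; case: (svalP J) => [[_ _ h] _]; apply: h => //; apply: KJ.
  by exists (exist _ U UP) => J AJ; apply/asboolP => x xJ; apply/asboolP; exists J.
have [|J K L' /asboolP JK /asboolP KL||[M [MI Md]] maxM] :=
    ZL_preorder (exist _ I0 I0P : T) (R := le).
- by move=> J; apply/asboolP.
- by apply/asboolP => x /JK/KL.
- exact: leT.
have MM : is_maximal_ideal (M : {pred R}).
  split=> // J JI MJ x.
  have JP : isI J by split=> //; apply: MJ.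
  have /asboolP JM := maxM (exist _ J JP) (asboolT MJ).
  by apply/idP/idP => [/JM|/MJ].
by exists (MaxIdeal MM).
Qed.

(** * Maximal ideals of finitely generated rings *)

(** The graph of the identity on the subset T is a partial homomorphism. *)
Lemma fg_ring_ind (R : idomainType) (T : R -> Prop) k (g : 'I_k -> R) (P : {mpoly int[k]}) :
  T 1 -> (forall x y, T x -> T y -> T (x - y)) -> (forall x y, T x -> T y -> T (x * y)) ->
  (forall i, T (g i)) -> T (mmap intr g P).
Proof.
move=> T1 TB TM Tg.
have hG : partial_hom (fun x y : R => T x /\ y = x).
  split=> // [x x' y y' [hx ->] [hx' ->]|x x' y y' [hx ->] [hx' ->]|y [_ ->] //].
    by split=> //; apply: TB.
  by split=> //; apply: TM.
have Ti c : T c%:~R /\ c%:~R = c%:~R :> R by apply: (ph_int hG).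
by case: (@ph_mmap _ _ _ hG _ _ (intr : {rmorphism int -> R}) intr g g P Ti _).
Qed.

Section FiniteResidue.
Variables (R : idomainType) (m : max_ideal R).
Hypotheses (hR : finitely_generated_ring R) (c0 : [pchar R] =i pred0)
  (fin : finite_set [set: residue_ring m]).

Lemma max_ideal_nat : exists2 N, (0 < N)%N & N%:R \in (m : {pred R}).
Proof using fin.
have [F [h [s [hm _ hs]]]] := residue_field fin.
pose t := [seq h k%:R | k <- iota 0 (size s).+1].
have : ~~ uniq t.
  apply/negP => ut; have := uniq_leq_size ut (fun x _ => hs x).
  by rewrite size_map size_iota ltnn.
move=> nut; have [k [l [kl e]]] : exists k l, (k < l)%N /\ h k%:R = h l%:R.
  apply: contrapT => H; case/negP: nut; rewrite map_inj_in_uniq ?iota_uniq //.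
  move=> k l _ _ e; case: (ltngtP k l) => // kl; case: H; first by exists k, l.
  by exists l, k.
exists (l - k)%N; first by rewrite subn_gt0.
by rewrite -hm natrB 1?ltnW // rmorphB /= e subrr.
Qed.

(** Choose representatives in R of the finitely many residue classes.  The
    relations that express their addition and multiplication tables and the
    classes of the generators of R are finitely many elements of m; modulo the
    ideal they generate, every element of R is congruent to a representative, so
    this ideal is m. *)
Lemma max_ideal_fg : exists k (v : 'I_k -> R), (forall i, v i \in (m : {pred R})) /\
  forall x, x \in (m : {pred R}) -> exists c : 'I_k -> R, x = \sum_i c i * v i.
Proof using hR fin.
have [F [h [s [hm hsurj hs]]]] := residue_field fin.
have [l [g hg]] := hR; have /choice[rep repK] := hsurj.
pose J := [:: 1 - rep 1] ++ [seq h' - rep (h h') | h' <- [seq g i | i : 'I_l]] ++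
  [seq rep x - rep y - rep (x - y) | x <- s, y <- s] ++
  [seq rep x * rep y - rep (x * y) | x <- s, y <- s].
have Jm x : x \in J -> x \in (m : {pred R}).
  rewrite -hm !mem_cat inE => /or4P[/eqP ->|/mapP[y _ ->]|/allpairsP[y [_ _ ->]]|/allpairsP[y [_ _ ->]]].
  - by rewrite rmorphB rmorph1 repK subrr.
  - by rewrite rmorphB repK subrr.
  - by rewrite !rmorphB !repK subrr.
  - by rewrite rmorphB rmorphM !repK subrr.
pose v (i : 'I_(size J)) := J`_i.
pose I x := exists c : 'I_(size J) -> R, x = \sum_i c i * v i.
have IMD a x y : I x -> I y -> I (a * x + y).
  move=> [c ->] [d ->]; exists (fun i => a * c i + d i).
  rewrite mulr_sumr -big_split; apply: eq_bigr => i _; rewrite mulrDl mulrA //.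
have I0 : I 0 by exists (fun=> 0); rewrite big1 // => i _; rewrite mul0r.
have IM a x : I x -> I (a * x) by move=> hx; rewrite -[_ * _]addr0; apply: IMD.
have ID x y : I x -> I y -> I (x + y) by move=> hx; rewrite -[x]mul1r; apply: IMD.
have IN x : I x -> I (- x) by move=> hx; rewrite -mulN1r; apply: IM.
have IJ x : x \in J -> I x.
  move=> xJ; have hi : (index x J < size J)%N by rewrite index_mem.
  exists (fun i => (i == Ordinal hi)%:R); rewrite (bigD1 (Ordinal hi)) //= eqxx mul1r.
  rewrite big1 ?addr0 /v /= ?nth_index // => i /negPf ->; exact: mul0r.
have IB' x y : I (rep x - rep y - rep (x - y)).
  apply: IJ; rewrite !mem_cat; apply/or4P/Or43/allpairsP.
  by exists (x, y); rewrite !hs.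
have IM' x y : I (rep x * rep y - rep (x * y)).
  apply: IJ; rewrite !mem_cat; apply/or4P/Or44/allpairsP.
  by exists (x, y); rewrite !hs.
have T r : I (r - rep (h r)).
  have [P ->] := hg r; apply: (@fg_ring_ind R (fun r => I (r - rep (h r)))).
  - by rewrite rmorph1; apply: IJ; rewrite !mem_cat inE eqxx.
  - move=> x y hx hy; rewrite rmorphB.
    have -> : x - y - rep (h x - h y) = (x - rep (h x)) + (- (y - rep (h y))) +
       (rep (h x) - rep (h y) - rep (h x - h y)) by ring.
    exact: ID _ _ (ID _ _ hx (IN _ hy)) (IB' _ _).
  - move=> x y hx hy; rewrite rmorphM.
    have -> : x * y - rep (h x * h y) = y * (x - rep (h x)) + (rep (h x) * (y - rep (h y))) +
       (rep (h x) * rep (h y) - rep (h x * h y)) by ring.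
    exact: ID _ _ (ID _ _ (IM y _ hx) (IM _ _ hy)) (IM' _ _).
  - move=> i; apply: IJ; rewrite !mem_cat; apply/or4P/Or42/mapP.
    by exists (g i) => //; apply/mapP; exists i; rewrite ?mem_enum.
exists (size J), v; split=> [i|x xm].
  by apply: Jm; apply: mem_nth.
have hx0 : h x = 0 by apply/eqP; rewrite hm.
have := ID _ _ (T x) (IN _ (IB' 0 0)).
by rewrite hx0 subrr sub0r opprK subr0 subrK.
Qed.

(** Nakayama's lemma: if m = m^2, generators v of m satisfy v = M v with M over
    m, so det (1 - M), which is 1 modulo m, annihilates m.  Then m = 0, although m
    contains a positive integer. *)
Lemma max_ideal_neq_square : exists2 x, x \in (m : {pred R}) & x \notin adic_ideal m 1.
Proof.
apply: contrapT => H.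
have m2 x : x \in (m : {pred R}) -> x \in adic_ideal m 1.
  by move=> xm; apply: contraT => x2; case: H; exists x.
have [k [v [vm vgen]]] := max_ideal_fg.
have [F [h [s [hm hsurj hs]]]] := residue_field fin.
have coef x : x \in (m : {pred R}) -> exists c : 'I_k -> R,
    (forall i, c i \in (m : {pred R})) /\ x = \sum_i c i * v i.
  move=> /m2/mem_adic1[t [ht ->]]; elim: t ht => [_|u t IH ht].
    exists (fun=> 0); split; first by move=> i; apply: max_ideal0.
    by rewrite big_nil big1 // => i _; rewrite mul0r.
  have [|c [cm ec]] := IH; first by move=> w wt; apply: ht; rewrite inE wt orbT.
  have [u1 /vgen[d ed]] := ht u (mem_head _ _).
  exists (fun i => d i * u.1 + c i); split=> [i|].
    by apply: max_idealMD.
  rewrite big_cons ec ed mulr_sumr -big_split; apply: eq_bigr => i _ /=.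
  by rewrite mulrDl mulrA [u.1 * d i]mulrC.
have /choice[M hM] : forall i, exists c : 'I_k -> R,
    (forall j, c j \in (m : {pred R})) /\ v i = \sum_j c j * v j.
  by move=> i; apply: coef.
pose A : 'M[R]_k := 1%:M - \matrix_(i, j) M i j.
pose V : 'cV[R]_k := \col_i v i.
have AV : A *m V = 0.
  apply/colP => i; rewrite mulmxBl mul1mx !mxE; apply/eqP; rewrite subr_eq0.
  by case: (hM i) => _ {1}->; apply/eqP/eq_bigr => j _; rewrite !mxE.
have dA : \det A != 0.
  have : h (\det A) != 0.
    rewrite -det_map_mx map_mxB map_mx1.
    have -> : map_mx h (\matrix_(i, j) M i j) = 0.
      by apply/matrixP => i j; rewrite !mxE; apply/eqP; rewrite hm; case: (hM i).
    by rewrite subr0 det1 oner_eq0.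
  by apply: contraNneq => ->; rewrite rmorph0.
have v0 i : v i = 0.
  have : (\adj A *m A) *m V = 0 by rewrite -mulmxA AV mulmx0.
  rewrite mul_adj_mx mul_scalar_mx => /colP/(_ i); rewrite !mxE => /eqP.
  by rewrite mulf_eq0 (negPf dA) => /eqP.
have [N N0 Nm] := max_ideal_nat.
have [c eN] := vgen _ Nm.
move/pcharf0P: c0 => /(_ N); rewrite eN big1 => [|i _]; last by rewrite v0 mulr0.
by rewrite eqxx => /esym/eqP e; rewrite e in N0.
Qed.

End FiniteResidue.

(** * The Jacobian determinant at the origin *)

Lemma mnm_ge2 n (m : 'X_{1..n}) : (1 < mdeg m)%N ->
  exists i j m', m = (U_(i) + U_(j) + m')%MM.
Proof.
have pick1 (k : 'X_{1..n}) : (0 < mdeg k)%N -> exists i k', k = (U_(i) + k')%MM.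
  rewrite lt0n mdeg_eq0 => k0; have [i ki] : exists i, k i != 0%N.
    apply: contrapT => h; case/eqP: k0; apply/mnmP => i; rewrite mnm0E.
    by apply/eqP; apply: contraT => hi; case: h; exists i.
  exists i, (k - U_(i))%MM; apply/mnmP => j; rewrite mnmDE mnmBE mnm1E.
  by case: eqP => [<-|]; lia.
move=> m1; have [|i [k ek]] := pick1 m; first exact: ltnW.
have [|j [k' ek']] := pick1 k; first by move: m1; rewrite ek mdegD mdeg1; lia.
by exists i, j, k'; rewrite ek ek' addmA.
Qed.

(** The error of the first order expansion at 0, for increments v whose pairwise
    products lie in an ideal I. *)
Lemma taylor1 n (R B : comNzRingType) (r : {rmorphism R -> B}) (v : 'I_n -> B)
    (I : B -> Prop) (P : {mpoly R[n]}) :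
  I 0 -> (forall x y, I x -> I y -> I (x + y)) -> (forall a x, I x -> I (a * x)) ->
  (forall i j, I (v i * v j)) ->
  I (mmap r v P - r P@_0%MM - \sum_j r P@_U_(j) * v j).
Proof.
move=> I0 ID IM Iv; elim/mpolyind: P => [|c m P _ _ IH].
  rewrite mmap0 !mcoeff0 rmorph0 subr0 sub0r big1 ?oppr0 // => j _.
  by rewrite mcoeff0 rmorph0 mul0r.
have : I (r c * (mmap r v 'X_[m] - r 'X_[m]@_0%MM - \sum_j r 'X_[m]@_U_(j) * v j)).
  apply: (IM); rewrite mmapX mcoeffX.
  under eq_bigr => j _ do rewrite mcoeffX.
  case: (ltngtP (mdeg m) 1%N) => [|m1|/eqP/mdeg1P[i /eqP ->]].
  - rewrite ltnS leqn0 mdeg_eq0 => /eqP ->; rewrite mmap11 eqxx rmorph1 subrr sub0r.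
    rewrite big1 ?oppr0 // => j _; rewrite eq_sym -mdeg_eq0 mdeg1.
    by rewrite rmorph0 mul0r.
  - have [i [j [m' em]]] := mnm_ge2 m1; rewrite big1 => [|k _]; last first.
      case: eqP => [e|]; last by rewrite rmorph0 mul0r.
      by move: m1; rewrite e mdeg1.
    case: eqP => [e|_]; first by move: m1; rewrite e mdeg0.
    rewrite rmorph0 !subr0 em.
    have mM m1' m2' : mmap1 v (m1' + m2')%MM = mmap1 v m1' * mmap1 v m2'.
      by apply: commr_mmap1_M => *; apply: mulrC.
    by rewrite !mM !mmap1U mulrC; apply: IM.
  rewrite mmap1U (bigD1 i) //= eqxx rmorph1 mul1r big1 => [|j ji]; last first.
    case: eqP => [/(congr1 (fun k : 'X_{1..n} => k i))|]; last by rewrite rmorph0 mul0r.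
    by rewrite !mnm1E eqxx (negPf ji).
  case: eqP => [e|_]; first by have := mdeg1 i; rewrite e mdeg0.
  by rewrite rmorph0 subr0 addr0 subrr.
move=> h; have := ID _ _ h IH; congr I.
rewrite mmapD mmapZ mcoeffD mcoeffZ rmorphD rmorphM !mulrBr.
rewrite [X in _ = _ - X](_ : _ = r c * (\sum_j r 'X_[m]@_U_(j) * v j) + \sum_j r P@_U_(j) * v j).
  by ring.
rewrite mulr_sumr -big_split; apply: eq_bigr => j _.
by rewrite mcoeffD mcoeffZ rmorphD rmorphM /=; ring.
Qed.

Definition jacobian0 (R : nzRingType) n (f : 'I_n -> {mpoly R[n]}) : 'M[R]_n :=
  \matrix_(i, j) (f i)@_U_(j)%MM.

Section JacobianUnit.
Variables (R : idomainType) (m : max_ideal R) (n : nat) (f : 'I_n -> {mpoly R[n]}).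
Hypothesis fin : finite_set [set: residue_ring m].
Hypothesis onto : forall k, (k < 2)%N -> forall b : 'I_n -> R, exists a : 'I_n -> R,
  forall i, (f i).@[a] - b i \in adic_ideal m k.

(** Let J be the Jacobian matrix at 0.  A solution a of f(a) = f(0) + e modulo
    m^2, with e in m^n, has its entries in m because f is injective modulo m, so
    that e = J a modulo m^2.  If u J = 0 modulo m with some u_i not in m, then
    the vector e with i-th entry x and zeros elsewhere gives u_i x in m^2, hence x
    in m^2. *)
Lemma det_jacobian0_notin x : x \in (m : {pred R}) -> x \notin adic_ideal m 1 ->
  \det (jacobian0 f) \notin (m : {pred R}).
Proof.
move=> xm; apply: contraNN; have [F [h [s [hm hsurj hs]]]] := residue_field fin.
have /choice[rep repK] := hsurj.
have inj (a a' : 'I_n -> F) : (forall i, mmap h a (f i) = mmap h a' (f i)) -> a =1 a'.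
  move=> e; apply: (@onto_injective_finite F s n (fun a i => mmap h a (f i)) hs _ _ _ _ e).
    by move=> b b' eb i; apply: eq_mmap.
  move=> y; have [b hb] := onto (isT : 0 < 2)%N (fun i => rep (y i)).
  exists (fun i => h (b i)) => i; have := hb i.
  rewrite mem_adic0 -hm rmorphB repK subr_eq0 => /eqP <-.
  by rewrite /meval rmorph_mmap.
rewrite -hm -det_map_mx => /det0P[u u0 uJ].
have [i0 ui0] : exists i, u 0 i != 0.
  apply: contrapT => H; case/eqP: u0; apply/rowP => i; rewrite mxE.
  by apply/eqP; apply: contraT => hi; case: H; exists i.
pose w i := rep (u 0 i).
have wJ j : \sum_i w i * (jacobian0 f) i j \in (m : {pred R}).
  rewrite -hm rmorph_sum; apply/eqP; have := congr1 (fun A : 'rV_n => A 0 j) uJ.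
  rewrite !mxE => e; rewrite -[RHS]e; apply: eq_bigr => i _.
  by rewrite rmorphM repK !mxE.
have [a ha] := onto (isT : 1 < 2)%N (fun i => (f i)@_0%MM + (i == i0)%:R * x).
have hclos := adic_ideal_closed m 1.
have J0 : 0 \in adic_ideal m 1 by case: hclos.
have JMD c y z : y \in adic_ideal m 1 -> z \in adic_ideal m 1 -> c * y + z \in adic_ideal m 1.
  by case: hclos => _ _; apply.
have JD y z : y \in adic_ideal m 1 -> z \in adic_ideal m 1 -> y + z \in adic_ideal m 1.
  by move=> hy hz; rewrite -[y]mul1r; apply: JMD.
have JM c y : y \in adic_ideal m 1 -> c * y \in adic_ideal m 1.
  by move=> hy; rewrite -[_ * _]addr0; apply: JMD.
have am i : a i \in (m : {pred R}).
  rewrite -hm; apply/eqP; apply: (inj (fun i => h (a i)) (fun=> 0)) => k.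
  have -> : mmap h (fun i => h (a i)) (f k) = h ((f k).@[a]) by rewrite /meval rmorph_mmap.
  have -> : mmap h (fun=> 0) (f k) = h (f k)@_0%MM.
    have := @taylor1 _ _ _ h (fun=> 0) (fun y => y = 0) (f k) erefl.
    rewrite big1 ?subr0 => [H|j _]; last by rewrite mulr0.
    apply/eqP; rewrite -subr_eq0; apply/eqP/H => [y z -> ->|c y ->|i' j].
    - exact: addr0.
    - exact: mulr0.
    - exact: mulr0.
  apply/eqP; rewrite -subr_eq0 -rmorphB hm.
  have : (f k).@[a] - (f k)@_0%MM - (k == i0)%:R * x \in (m : {pred R}).
    rewrite -mem_adic0 -addrA -opprD.
    exact: (@ideal_expS _ m 1 _ (ha k)).
  by move=> hk; rewrite -(subrK ((k == i0)%:R * x) (_ - _)) max_idealD // max_idealM.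
have tay i : (i == i0)%:R * x - \sum_j (jacobian0 f) i j * a j \in adic_ideal m 1.
  have := @taylor1 _ _ _ idfun a (fun y => y \in adic_ideal m 1) (f i) J0 JD JM _.
  move=> /(_ (fun k l => mem_adic1_mul (am k) (am l))) /= h1.
  move: (JMD (-1) _ _ (ha i) h1); rewrite /meval.
  have -> : \sum_j (f i)@_U_(j) * a j = \sum_j (jacobian0 f) i j * a j.
    by apply: eq_bigr => j _; rewrite mxE.
  set t := mmap _ _ _; set z := \sum_j _; set c := _@__.
  by have -> : -1 * (t - (c + (i == i0)%:R * x)) + (t - c - z) = (i == i0)%:R * x - z by ring.
have : \sum_i w i * ((i == i0)%:R * x - \sum_j (jacobian0 f) i j * a j) \in adic_ideal m 1.
  by elim/big_ind: _ => [|y z hy hz|i _]; [exact: J0|exact: JD|exact: JM (tay i)].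
have -> : \sum_i w i * ((i == i0)%:R * x - \sum_j (jacobian0 f) i j * a j) =
   w i0 * x - \sum_j (\sum_i w i * (jacobian0 f) i j) * a j.
  under eq_bigr do rewrite mulrBr.
  rewrite sumrB; congr (_ - _).
    rewrite (bigD1 i0) //= eqxx mul1r big1 ?addr0 // => i /negPf ->.
    by rewrite mul0r mulr0.
  under eq_bigr do rewrite mulr_sumr.
  rewrite exchange_big; apply: eq_bigr => j _; rewrite mulr_suml.
  by apply: eq_bigr => i _; rewrite mulrA.
move=> h1; have h2 : \sum_j (\sum_i w i * (jacobian0 f) i j) * a j \in adic_ideal m 1.
  by elim/big_ind: _ => [|y z hy hz|j _]; [exact: J0|exact: JD|exact: mem_adic1_mul].
have h3 := JD _ _ h1 h2; rewrite subrK in h3.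
have [y hy] : exists y, 1 - w i0 * y \in (m : {pred R}).
  by apply: max_ideal_inv; rewrite -hm repK.
have -> : x = y * (w i0 * x) + (1 - w i0 * y) * x by ring.
by apply: JMD => //; apply: mem_adic1_mul.
Qed.
End JacobianUnit.

(** * Removing the denominators *)

Section Integrality.
Variables (R : idomainType) (n : nat).

(** Here f = x + (terms of degree at least 2).  Replace x by t x: then f_i
    becomes t (x_i + t u_i), and a monomial of degree d contributes to the
    coefficient of t^k in A(f) only if d <= k, and its own value if d = k.  So
    the homogeneous components of A are divisible by s one after the other. *)
Lemma dvd_coef_of_dvd_subst_normal (f : 'I_n -> {mpoly R[n]}) (s : R) (A Q : {mpoly R[n]}) :
  (forall i, (f i)@_0%MM = 0) -> jacobian0 f = 1%:M -> subst_map f A = s *: Q ->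
  forall m, exists c, A@_m = s * c.
Proof.
move=> f0 fJ eA.
pose r : {rmorphism R -> {poly {mpoly R[n]}}} := polyC \o @mpolyC n R.
pose v i : {poly {mpoly R[n]}} := ('X_i)%:P * 'X.
have /choice[G hG] : forall i, exists g : {poly {mpoly R[n]}},
    g`_0 = 'X_i /\ mmap r v (f i) = 'X * g.
  move=> i; have := @taylor1 _ _ _ r v (fun P => exists Q, P = 'X^2 * Q) (f i) _ _ _ _.
  case=> [|x y [a ->] [b ->]|a x [b ->]|k l|u].
  - by exists 0; rewrite mulr0.
  - by exists (a + b); rewrite mulrDr.
  - by exists (a * b); rewrite mulrCA.
  - by exists ('X_k * 'X_l)%:P; rewrite /v polyCM; ring.
  rewrite f0 rmorph0 subr0 (bigD1 i) //= big1 => [|j ji]; last first.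
    have := congr1 (fun M : 'M_n => M i j) fJ; rewrite !mxE eq_sym (negPf ji) => ->.
    by rewrite /r /= mpolyC0 polyC0 mul0r.
  have := congr1 (fun M : 'M_n => M i i) fJ; rewrite !mxE eqxx => ->.
  rewrite addr0 rmorph1 mul1r => /eqP; rewrite subr_eq => /eqP e.
  exists (('X_i)%:P + 'X * u); rewrite coefD coefC coefXM addr0; split=> //.
  by rewrite e /v mulrDr [X in _ = X + _]mulrC mulrA -expr2 addrC.
(* G i is x_i + t u_i, with 'X in the role of t. *)
have key : \sum_(m <- msupp A) r A@_m * ('X^(mdeg m) * mmap1 G m) = r s * mmap r v Q.
  have := congr1 (mmap r v) eA; rewrite mmapZ [X in X = _]mmap_mmap => <-.
  apply: eq_bigr => m _; congr (_ * _); rewrite -mmap1_scale.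
  by apply: mmap1_eq => i; case: (hG i).
have dvd k : forall m, (mdeg m < k)%N -> exists c, A@_m = s * c.
  elim: k => // k IH m; rewrite ltnS leq_eqVlt => /predU1P[mk|]; last exact: IH.
  have [mA|mA] := boolP (m \in msupp A); last first.
    by exists 0; rewrite mulr0 memN_msupp_eq0.
  have := congr1 (fun P : {poly {mpoly R[n]}} => (P`_k)@_m) key.
  rewrite [RHS](_ : _ = s * ((mmap r v Q)`_k)@_m); last first.
    by rewrite /r /= coefCM mcoeffCM.
  rewrite coef_sum raddf_sum (bigD1_seq m) ?msupp_uniq //=.
  set rest := \sum_(_ <- _ | _) _.
  have [c ->] : exists c, rest = s * c.
    rewrite /rest; apply: (big_ind (fun z => exists c, z = s * c)).
    - by exists 0; rewrite mulr0.
    - by move=> _ _ [a ->] [b ->]; exists (a + b); rewrite mulrDr.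
    move=> m' mm'; rewrite coefCM mcoeffCM.
    have [lt|] := ltnP (mdeg m') k.
      by have [c ->] := IH m' lt; exists (c * ('X^(mdeg m') * mmap1 G m')`_k@_m); rewrite mulrA.
    rewrite coefXnM leq_eqVlt => /predU1P[e|->]; last by exists 0; rewrite mcoeff0 !mulr0.
    exists 0; rewrite e ltnn subnn mulr0.
    have -> : (mmap1 G m')`_0 = 'X_[m'].
      rewrite -horner_coef0 /mmap1 horner_prod mpolyXE_id; apply: eq_bigr => i _.
      by rewrite horner_exp horner_coef0; case: (hG i) => ->.
    by rewrite mcoeffX (negPf mm') mulr0.
  rewrite coefCM mcoeffCM coefXnM mk ltnn subnn.
  have -> : (mmap1 G m)`_0 = 'X_[m].
    rewrite -horner_coef0 /mmap1 horner_prod mpolyXE_id; apply: eq_bigr => i _.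
    by rewrite horner_exp horner_coef0; case: (hG i) => ->.
  rewrite mcoeffX eqxx mulr1 => e; exists ((mmap r v Q)`_k@_m - c).
  by rewrite mulrBr -e addrK.
by move=> m; apply: (dvd (mdeg m).+1).
Qed.

(** An affine change of the target coordinates brings f to the form
    x + (terms of degree at least 2). *)
Lemma dvd_of_dvd_subst (f : 'I_n -> {mpoly R[n]}) (s : R) (A Q : {mpoly R[n]}) :
  jacobian0 f \in unitmx -> subst_map f A = s *: Q -> exists C, A = s *: C.
Proof.
move=> uJ eA; pose J := jacobian0 f; pose K := invmx J.
pose c i := (f i)@_0%MM.
pose f' i := \sum_j K i j *: (f j - (c j)%:MP).
pose A' := subst_map (fun i => (c i)%:MP + \sum_j J i j *: 'X_j) A.
have f'0 i : (f' i)@_0%MM = 0.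
  rewrite /f' raddf_sum /= big1 // => j _.
  by rewrite mcoeffZ mcoeffB mcoeffC eqxx mulr1 subrr mulr0.
have f'J : jacobian0 f' = 1%:M.
  rewrite -(mulVmx uJ); apply/matrixP => i k; rewrite !mxE raddf_sum; apply: eq_bigr => j _.
  rewrite /= mcoeffZ mcoeffB mcoeffC mxE; case: eqP => [/(congr1 (@mdeg n))|_].
    by rewrite mdeg1 mdeg0.
  by rewrite mulr0 subr0.
have substZ (g : 'I_n -> {mpoly R[n]}) a P : subst_map g (a *: P) = a *: subst_map g P.
  by rewrite /subst_map /= mmapZ mul_mpolyC.
have JK i k : \sum_j J i j * K j k = (i == k)%:R.
  by have := congr1 (fun M : 'M_n => M i k) (mulmxV uJ); rewrite !mxE.
have KJ i k : \sum_j K i j * J j k = (i == k)%:R.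
  by have := congr1 (fun M : 'M_n => M i k) (mulVmx uJ); rewrite !mxE.
have delta (M : 'I_n -> 'I_n -> R) (g : 'I_n -> {mpoly R[n]}) i :
    (forall k, M i k = (i == k)%:R) -> \sum_k M i k *: g k = g i.
  move=> hM; rewrite (bigD1 i) //= hM eqxx scale1r big1 ?addr0 // => k ki.
  by rewrite hM eq_sym (negPf ki) scale0r.
have eA' : subst_map f' A' = s *: Q.
  rewrite -eA [LHS]mmap_mmap; apply: eq_mmap => // i.
  rewrite rmorphD /= mmapC rmorph_sum /=.
  under eq_bigr => j _ do rewrite mmapZ mmap1Ui mul_mpolyC /f' scaler_sumr.
  rewrite exchange_big /=.
  under eq_bigr => k _.
    under eq_bigr do rewrite scalerA.
    rewrite -scaler_suml; over.
  by rewrite (delta (fun i k => \sum_j J i j * K j k)) // addrC subrK.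
have /choice[C0 hC0] := dvd_coef_of_dvd_subst_normal f'0 f'J eA'.
pose C1 : {mpoly R[n]} := \sum_(m <- msupp A') C0 m *: 'X_[m].
have eA1 : A' = s *: C1.
  rewrite {1}[A']mpolyE scaler_sumr; apply: eq_bigr => m _.
  by rewrite hC0 scalerA.
pose g i := \sum_j K i j *: ('X_j - (c j)%:MP).
exists (subst_map g C1); rewrite -substZ -eA1 [RHS]mmap_mmap -[LHS]mmap_mpolyX.
apply: eq_mmap => // i; rewrite rmorphD /= mmapC rmorph_sum /=.
under eq_bigr => j _ do rewrite mmapZ mmap1Ui mul_mpolyC /g scaler_sumr.
rewrite exchange_big /=.
under eq_bigr => k _.
  under eq_bigr do rewrite scalerA.
  rewrite -scaler_suml; over.
by rewrite (delta (fun i k => \sum_j J i j * K j k)) // addrC subrK.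
Qed.
End Integrality.

(** * The theorem *)

(** A maximal ideal with finite residue ring contains a positive integer, which
    would be invertible in the subfield. *)
Lemma finite_quotients_no_subfield (R : idomainType) (K : {pred R}) :
  [pchar R] =i pred0 -> finite_quotients R -> ~ is_subfield K.
Proof.
move=> c0 hfin [[K1 KB _] Kinv].
have [m _] : exists m : max_ideal R, 0 \in (m : {pred R}).
  by apply: exists_max_ideal => y; rewrite mul0r eq_sym oner_eq0.
have [N N0 Nm] := max_ideal_nat (hfin m).
have KN : N%:R \in K.
  have K0 : 0 \in K by rewrite -(subrr 1) KB.
  elim: (N) => [|k IH] //.
  by rewrite -addn1 natrD -[1%:R]opprK KB // -sub0r KB.
have [|y _ Ny] := Kinv _ KN.
  by move/pcharf0P: c0 => ->; rewrite -lt0n.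
by have := max_ideal1 m; rewrite -Ny mulrC max_idealM.
Qed.

(** F_p is a field and r is onto, since the residues are classes of integers. *)
Lemma kernel_max_ideal (R : comNzRingType) p (r : {rmorphism R -> 'F_p}) :
  exists m : max_ideal R, forall x, (x \in (m : {pred R})) = (r x == 0).
Proof.
pose K : {pred R} := fun x => r x == 0.
have KI : is_maximal_ideal K.
  split.
    split; rewrite ?unfold_in /K.
    - by rewrite rmorph0.
    - by rewrite rmorph1 oner_eq0.
    move=> a x y; rewrite !unfold_in => /eqP rx /eqP ry.
    by rewrite rmorphD rmorphM rx ry mulr0 addr0.
  move=> J [J0 J1 JMD] KJ x; apply/idP/idP => [xJ|/KJ //].
  rewrite unfold_in; apply: contraNT J1 => rx.
  have JM a z : z \in J -> a * z \in J by move=> zJ; rewrite -[_ * _]addr0 JMD.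
  pose y : R := ((r x)^-1 : nat)%:R.
  have zK : 1 - y * x \in K.
    by rewrite unfold_in rmorphB rmorph1 rmorphM /y rmorph_nat natr_Zp mulVf ?subrr.
  have := JMD 1 _ _ (KJ _ zK) (JM y _ xJ); by rewrite mul1r subrK.
by exists (MaxIdeal KI).
Qed.

Definition adically_onto (R : comNzRingType) n (f : 'I_n -> {mpoly R[n]}) : Prop :=
  forall (m : max_ideal R) k (b : 'I_n -> R), exists a : 'I_n -> R,
    forall i, (f i).@[a] - b i \in adic_ideal m k.

(** If C_i(f) = s_i x_i with C_i = s_i g_i, then g(f(x)) = x; substituting f for y
    in f(g(y)) gives f(x), so f(g(y)) = y because this substitution is
    injective. *)
Theorem polynomial_right_inverse (R : idomainType) n (f : 'I_n -> {mpoly R[n]}) :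
  finitely_generated_ring R -> [pchar R] =i pred0 -> finite_quotients R ->
  adically_onto f ->
  exists g : 'I_n -> {mpoly R[n]}, forall i, mmap (@mpolyC n R) g (f i) = 'X_i.
Proof.
move=> hR c0 hfin onto.
have ronto : reductions_onto f.
  move=> p r pp b; have [m hm] := kernel_max_ideal r.
  have [a ha] := onto m 0%N (fun i => (b i : nat)%:R).
  exists (fun i => r (a i)) => i; have := ha i.
  rewrite mem_adic0 hm rmorphB rmorph_nat natr_Zp subr_eq0 => /eqP <-.
  by rewrite /meval rmorph_mmap.
have uJ : jacobian0 f \in unitmx.
  rewrite unitmxE; apply: contraT => nu.
  have [|m] := @exists_max_ideal R (\det (jacobian0 f)).
    by move=> y; apply: contraNneq nu => e; apply/unitrPr; exists y.
  have [x xm x2] := max_ideal_neq_square hR c0 (hfin m).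
  by rewrite (negPf (det_jacobian0_notin (hfin m) (fun k _ => onto m k) xm x2)).
have /choice[g hg] : forall i, exists g, subst_map f g = 'X_i.
  move=> i; have [C [s [s0 eC]]] := polynomial_inverse hR c0 i ronto.
  have [g eg] := dvd_of_dvd_subst uJ eC; exists g.
  have s0' : s%:MP != 0 :> {mpoly R[n]} by rewrite mpolyC_eq0.
  apply: (mulfI s0'); rewrite !mul_mpolyC -eC eg.
  by rewrite -mul_mpolyC /subst_map /= mmapZ.
exists g => i; apply: (subst_map_injective hR c0 ronto).
rewrite [LHS]mmap_mmap /subst_map /= mmap1Ui -[RHS]mmap_mpolyX.
exact: eq_mmap.
Qed.

Lemma subring_mmap (R A : comNzRingType) n (S : subringClosed A) (r : R -> A)
    (u : 'I_n -> A) (P : {mpoly R[n]}) :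
  (forall c, r c \in S) -> (forall i, u i \in S) -> mmap r u P \in S.
Proof.
move=> rS uS; apply: rpred_sum => m _; apply: rpredM => //.
by apply: rpred_prod => i _; apply: rpredX.
Qed.

(** Project a solution in the completion to R / m^(k+1) and lift it to R. *)
Lemma adically_onto_of_completions (R : idomainType) n (f : 'I_n -> {mpoly R[n]}) :
  (forall (m : max_ideal R) (b : 'I_n -> R), exists a : 'I_n -> completion m,
     forall i, mmap (to_completion m) a (f i) = to_completion m (b i)) ->
  adically_onto f.
Proof.
move=> onto m k b; have [a' ha'] := onto m b.
have /choice[a ha] : forall i, exists r, cproj (a' i) k = adic_proj m k r.
  by move=> i; apply: adic_proj_surj.
exists a => i; apply/adic_projP.
pose G (x : completion m) (y : adic_quot m k) := y = cproj x k.
have hG : partial_hom G by split=> // [x x' y y' -> ->|x x' y y' -> ->].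
have h1 := @ph_mmap _ _ _ hG _ _ (to_completion m) (adic_proj m k) a' (fun i => cproj (a' i) k) (f i)
  (fun c => erefl) (fun i => erefl).
transitivity (mmap (adic_proj m k) (fun i => cproj (a' i) k) (f i)).
  by rewrite /meval rmorph_mmap; apply: eq_mmap => // j /=; rewrite ha.
by rewrite h1 ha'.
Qed.

Theorem corollary2p3 (R : idomainType)
    (hR : affine_domain R) (hchar : [pchar R] =i pred0)
    (hfin : finite_quotients R)
    (n : nat) (hn : (0 < n)%N) (f : 'I_n -> {mpoly R[n]})
    (S : forall m : max_ideal R, subringClosed (completion m))
    (hS : forall (m : max_ideal R) (r : R), to_completion m r \in S m) :
  (forall b : 'I_n -> R, exists a : 'I_n -> R, poly_map idfun f a =1 b) <->
  (forall (m : max_ideal R) (b : 'I_n -> completion m),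
     (forall i, b i \in S m) ->
     exists2 a : 'I_n -> completion m,
       (forall i, a i \in S m) & poly_map (to_completion m) f a =1 b).
Proof.
have hR' : finitely_generated_ring R.
  by case: hR => // -[K hK _]; case: (finite_quotients_no_subfield hchar hfin hK).
have solve (A : comNzRingType) (r : {rmorphism R -> A}) (g : 'I_n -> {mpoly R[n]}) (b : 'I_n -> A) :
    (forall i, mmap (@mpolyC n R) g (f i) = 'X_i) ->
    poly_map r f (fun i => mmap r b (g i)) =1 b.
  by move=> hg i; rewrite /poly_map -(mmap1Ui r b i) -hg [RHS]mmap_mmap.
split=> [onto m b bS|onto].
  have aonto : adically_onto f.
    move=> m' k c; have [a ha] := onto c; exists a => i.
    rewrite -(ha i) /poly_map subrr.
    by case: (adic_ideal_closed m' k).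
  have [g hg] := polynomial_right_inverse hR' hchar hfin aonto.
  exists (fun i => mmap (to_completion m) b (g i)); last exact: solve.
  by move=> i; exact: subring_mmap (hS m) bS.
have aonto : adically_onto f.
  apply: adically_onto_of_completions => m b.
  have [|a _ ha] := onto m (fun i => to_completion m (b i)).
    by move=> i; apply: hS.
  by exists a.
have [g hg] := polynomial_right_inverse hR' hchar hfin aonto.
by move=> b; exists (fun i => mmap idfun b (g i)); apply: (solve _ idfun).
Qed.
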